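(* Let $(X,d)$ be a complete metric space with $\operatorname{diam}X<\infty$, and let $\phi_1,\phi_2:X\to(-\infty,\infty]$ be lower semi-continuous functions with $D(\phi_1)\cap D(\phi_2)\neq\emptyset$, each satisfying the compactness condition (d) of the context, and such that $\phi_i$ is $\lambda_i$-convex for some $\lambda_i\in\mathbb{R}$ ($i=1,2$). Assume that we are in one of the following two cases (made precise in the context): (Case I) $(X,d)$ is a $\mathrm{CAT}(1)$-space; or (Case II) $(X,d)$ satisfies the commutativity and the $K$-convexity of the squared distance function for some $K\in\mathbb{R}$, the commutativity, the $K$-convexity and the $\lambda_i$-convexity of $\phi_i$ holding along the same family of geodesics. Put $\phi:=\phi_1+\phi_2$, let $z_0\in D(\phi)$, and suppose that the summability condition (e) of the context holds for $z_0$. Then the interpolated curve $\bar{z}_{\boldsymbol{\tau}}$ of the alternating scheme for $(\phi_1,\phi_2)$ starting from $z_0$ converges to the gradient curve $\xi:=\mathcal{G}(\cdot,z_0)$ of $\phi$ as $|\boldsymbol{\tau}|\to0$, uniformly on each bounded interval $[0,T]$.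
   Context: Setting. A minimal geodesic is a curve $\gamma:[0,1]\to X$ with $d(\gamma(s),\gamma(t))=|s-t|\,d(\gamma(0),\gamma(1))$ for all $s,t\in[0,1]$; $X$ is geodesic if any two points are joined by a minimal geodesic. $D(f):=X\setminus f^{-1}(\infty)$. The numbers $\lambda_1,\lambda_2,K$ may be negative. $\lambda$-convexity. $f:X\to(-\infty,\infty]$ is $\lambda$-convex if for any $x,y\in D(f)$ there is a minimal geodesic $\gamma$ from $x$ to $y$ along which, for all $t\in[0,1]$, (a) $f(\gamma(t))\le(1-t)f(x)+tf(y)-\frac{\lambda}{2}(1-t)t\,d^2(x,y)$. Case I. $(X,d)$ is a complete $\mathrm{CAT}(1)$-space, i.e. a complete geodesic metric space such that for any $x,y,z\in X$ with $d(x,y)+d(y,z)+d(z,x)<2\pi$ and any minimal geodesic $\gamma$ from $y$ to $z$, one has $d(x,\gamma(t))\le d_{\mathbb{S}^2}(\tilde x,\tilde\gamma(t))$ for all $t\in[0,1]$, where $\tilde x,\tilde y,\tilde z$ in the unit sphere $\mathbb{S}^2$ have the same pairwise distances as $x,y,z$ and $\tilde\gamma$ is the minimal geodesic from $\tilde y$ to $\tilde z$. (No bound on the diameter other than $\operatorname{diam}X<\infty$ is required.) Case II. There are $K\in\mathbb{R}$ and a family $\Gamma$ of minimal geodesics in $X$, containing for every $x,y\in X$ at least one minimal geodesic from $x$ to $y$, such that (a) holds with $f=\phi_i$, $\lambda=\lambda_i$ ($i=1,2$) along every $\gamma\in\Gamma$ with endpoints in $D(\phi_i)$, and: (b) ($K$-convexity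 of the squared distance) for every $z\in X$, $\gamma\in\Gamma$, $t\in[0,1]$, $d^2(z,\gamma(t))\le(1-t)d^2(z,\gamma(0))+t\,d^2(z,\gamma(1))-\frac{K}{2}(1-t)t\,d^2(\gamma(0),\gamma(1))$; (c) (commutativity) for all $\gamma,\eta\in\Gamma$ with $\gamma(0)=\eta(0)=x$, $\gamma(1)=y$, $\eta(1)=z$: $\lim_{s\downarrow 0}\frac{d^2(\gamma(s),z)-d^2(x,z)}{s}=\lim_{t\downarrow 0}\frac{d^2(\eta(t),y)-d^2(x,y)}{t}$. (d) (Compactness, in both cases) for $i=1,2$ and any $Q\in\mathbb{R}$, bounded subsets of $\{x\in X:\phi_i(x)\le Q\}$ are relatively compact in $X$. For $f:X\to(-\infty,\infty]$, $x\in X$, $\tau>0$, set $J^f_\tau(x):=\{z\in X: f(z)+\frac{d^2(x,z)}{2\tau}=\inf_{w\in X}[f(w)+\frac{d^2(x,w)}{2\tau}]\}$. In this setting $\phi_1,\phi_2,\phi$ are bounded below and $J^{\phi_1}_\tau(x),J^{\phi_2}_\tau(x),J^{\phi}_\tau(x)$ are nonempty for all $x\in X$, $\tau>0$. Partitions. A partition is $\mathscr{P}_{\boldsymbol{\tau}}=\{0=t^0_{\boldsymbol{\tau}}<t^1_{\boldsymbol{\tau}}<\cdots\}$ with $t^k_{\boldsymbol{\tau}}\to\infty$; $\tau_k:=t^k_{\boldsymbol{\tau}}-t^{k-1}_{\boldsymbol{\tau}}$, $|\boldsymbol{\tau}|:=\sup_{k\ge1}\tau_k$. Gradient curve of $\phi$.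 For $z_0\in D(\phi)$, a discrete solution for $\phi$ is $x^0_{\boldsymbol{\tau}}=z_0$, $x^k_{\boldsymbol{\tau}}\in J^\phi_{\tau_k}(x^{k-1}_{\boldsymbol{\tau}})$ for $k\ge1$; put $\bar{x}_{\boldsymbol{\tau}}(0)=z_0$ and $\bar{x}_{\boldsymbol{\tau}}(t)=x^k_{\boldsymbol{\tau}}$ for $t\in(t^{k-1}_{\boldsymbol{\tau}},t^k_{\boldsymbol{\tau}}]$. In Case II, and in Case I when $\operatorname{diam}X<\pi/2$, as $|\boldsymbol{\tau}|\to0$ the curves $\bar{x}_{\boldsymbol{\tau}}$ converge uniformly on bounded intervals to a curve $\xi:[0,\infty)\to D(\phi)$ independent of the choices, and $\mathcal{G}(t,z_0):=\xi(t)$. In Case I when $\operatorname{diam}X\ge\pi/2$, this construction is carried out locally: restricted to the (geodesically convex) open ball $B(z_0,\pi/6)$ it yields $\xi$ up to the time $t_1$ when $\xi$ hits $\partial B(z_0,\pi/6)$; it is then restarted from $\xi(t_1)$ in $B(\xi(t_1),\pi/6)$, and so on; iterating gives $\xi:[0,\infty)\to X$, and again $\mathcal{G}(t,z_0):=\xi(t)$. Alternating scheme. Given $z_0\in D(\phi)=D(\phi_1)\cap D(\phi_2)$ and $\mathscr{P}_{\boldsymbol{\tau}}$, put $z^0_{\boldsymbol{\tau}}:=z_0$ and choose arbitrary $\hat z^k_{\boldsymbol{\tau}}\in J^{\phi_1}_{\tau_k}(z^{k-1}_{\boldsymbol{\tau}})$ and then $z^k_{\boldsymbol{\tau}}\in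 J^{\phi_2}_{\tau_k}(\hat z^k_{\boldsymbol{\tau}})$ for $k\ge1$. Set $\bar{z}_{\boldsymbol{\tau}}(0):=z_0$, $\bar{z}_{\boldsymbol{\tau}}(t):=z^k_{\boldsymbol{\tau}}$ for $t\in(t^{k-1}_{\boldsymbol{\tau}},t^k_{\boldsymbol{\tau}}]$. Set $\delta^k_{\boldsymbol{\tau}}(z_0):=\max\{0,\ \phi_2(\hat z^k_{\boldsymbol{\tau}})-\phi_2(z^{k-1}_{\boldsymbol{\tau}}),\ \phi_1(z^k_{\boldsymbol{\tau}})-\phi_1(\hat z^k_{\boldsymbol{\tau}})\}$. (e) (Summability) For any $\varepsilon,T>0$ there is $\Delta^T_\varepsilon(z_0)<\infty$ such that $\sum_{k=1}^N\delta^k_{\boldsymbol{\tau}}(z_0)\le\Delta^T_\varepsilon(z_0)$ for any partition $\mathscr{P}_{\boldsymbol{\tau}}$ with $|\boldsymbol{\tau}|<\varepsilon$, any $N\in\mathbb{N}$ with $t^N_{\boldsymbol{\tau}}\le T$, and any solution $\{\hat z^k_{\boldsymbol{\tau}},z^k_{\boldsymbol{\tau}}\}_{k\ge1}$ of the alternating scheme from $z_0$. (In particular $\hat z^k_{\boldsymbol{\tau}},z^k_{\boldsymbol{\tau}}\in D(\phi)$.) *)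

(* Defs.v *)
From HB Require Import structures.
From mathcomp Require Export all_boot all_order all_algebra.
From mathcomp Require Export all_classical all_reals all_analysis.

Set Implicit Arguments.
Unset Strict Implicit.
Unset Printing Implicit Defensive.

Import Order.TTheory GRing.Theory Num.Theory.
Import numFieldNormedType.Exports.

Local Open Scope classical_set_scope.
Local Open Scope ring_scope.

(* Curves are total functions [R -> T]; only their values on [0, 1] (for
   geodesics) or on [0, +oo[ (for gradient curves) are ever constrained.
   The distance is an explicit argument so that the definition also applies
   to the unit sphere with its angular distance. *)
Definition minimal_geodesic (R : realType) (T : Type) (d : T -> T -> R)
    (g : R -> T) : Prop :=
  forall s t : R, 0 <= s <= 1 -> 0 <= t <= 1 ->
    d (g s) (g t) = `|s - t| * d (g 0) (g 1).

Definition dot (R : realType) (u v : 'rV[R]_3) : R :=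
  \sum_(i < 3) u 0 i * v 0 i.

Definition sphere (R : realType) : set 'rV[R]_3 := [set u | dot u u = 1].

Definition sphere_dist (R : realType) (u v : 'rV[R]_3) : R := acos (dot u v).

Section MetricSpace.
Context {R : realType} {X : metricType R}.
Implicit Types (f phi : X -> \bar R) (t : nat -> R) (xi : R -> X).

(* The completeness axiom of the library, without its pointedness. *)
Definition complete_space : Prop :=
  forall F : set_system X, ProperFilter F -> cauchy F -> exists l : X, F --> l.

Definition diam : \bar R :=
  ereal_sup [set (mdist p.1 p.2)%:E | p in [set: X * X]].

Definition geodesic_space : Prop :=
  forall x y : X, exists g : R -> X,
    [/\ minimal_geodesic mdist g, g 0 = x & g 1 = y].

(* The condition on the perimeter makes comparison triangles exist and be
   unique up to isometry of the sphere. *)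
Definition CAT1_space : Prop :=
  geodesic_space /\
  forall (x y z : X) (g : R -> X),
    mdist x y + mdist y z + mdist z x < 2 * pi ->
    minimal_geodesic mdist g -> g 0 = y -> g 1 = z ->
    forall (x' y' z' : 'rV[R]_3) (g' : R -> 'rV[R]_3),
      sphere x' -> sphere y' -> sphere z' ->
      sphere_dist x' y' = mdist x y ->
      sphere_dist y' z' = mdist y z ->
      sphere_dist z' x' = mdist z x ->
      (forall t : R, 0 <= t <= 1 -> sphere (g' t)) ->
      minimal_geodesic (@sphere_dist R) g' -> g' 0 = y' -> g' 1 = z' ->
      forall t : R, 0 <= t <= 1 -> mdist x (g t) <= sphere_dist x' (g' t).

Definition dom f : set X := ~` (f @^-1` [set +oo%E]).

Definition convex_along f (lambda : R) (g : R -> X) : Prop :=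
  forall t : R, 0 <= t <= 1 ->
    (f (g t) <= (1 - t)%:E * f (g 0%R) + t%:E * f (g 1%R)
                - (lambda / 2 * (1 - t) * t * mdist (g 0) (g 1) ^+ 2)%R%:E)%E.

Definition lambda_convex f (lambda : R) : Prop :=
  forall x y : X, dom f x -> dom f y -> exists g : R -> X,
    [/\ minimal_geodesic mdist g, g 0 = x, g 1 = y & convex_along f lambda g].

Definition K_convex_sqdist (K : R) (Gamma : set (R -> X)) : Prop :=
  forall (z : X) (g : R -> X), Gamma g -> forall t : R, 0 <= t <= 1 ->
    mdist z (g t) ^+ 2 <=
      (1 - t) * mdist z (g 0) ^+ 2 + t * mdist z (g 1) ^+ 2
      - K / 2 * (1 - t) * t * mdist (g 0) (g 1) ^+ 2.

(* Both one-sided limits exist and they coincide. *)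
Definition commutative_along (Gamma : set (R -> X)) : Prop :=
  forall g h : R -> X, Gamma g -> Gamma h -> g 0 = h 0 ->
    exists l : R,
      ((mdist (g s) (h 1) ^+ 2 - mdist (g 0) (h 1) ^+ 2) / s) @[s --> 0^'+]
        --> l /\
      ((mdist (h s) (g 1) ^+ 2 - mdist (g 0) (g 1) ^+ 2) / s) @[s --> 0^'+]
        --> l.

Definition commutative_K_convex_setting (phi1 phi2 : X -> \bar R)
    (lambda1 lambda2 : R) : Prop :=
  exists (K : R) (Gamma : set (R -> X)),
    [/\ Gamma `<=` minimal_geodesic mdist,
        forall x y : X, exists2 g, Gamma g & g 0 = x /\ g 1 = y,
        (forall g, Gamma g -> dom phi1 (g 0) -> dom phi1 (g 1) ->
           convex_along phi1 lambda1 g) /\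
        (forall g, Gamma g -> dom phi2 (g 0) -> dom phi2 (g 1) ->
           convex_along phi2 lambda2 g),
        K_convex_sqdist K Gamma &
        commutative_along Gamma].

Definition compact_sublevels f : Prop :=
  forall (Q : R) (B : set X),
    (exists (c : X) (r : R), B `<=` ball c r) ->
    B `<=` [set x | (f x <= Q%:E)%E] -> precompact B.

(* [prox setT f tau x] is J^f_tau(x); a general [S] restricts the
   minimization to the subspace [S] of [X]. *)
Definition prox (S : set X) f (tau : R) (x : X) : set X :=
  let F w := (f w + (mdist x w ^+ 2 / (2 * tau))%:E)%E in
  [set z | S z /\ F z = ereal_inf (F @` S)].

Definition partition_of_half_line t : Prop :=
  [/\ t 0%N = 0, forall k, t k < t k.+1 & t @ \oo --> +oo].

Definition mesh t : \bar R := ereal_sup (range (fun k => (t k.+1 - t k)%:E)).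

(* The index [k >= 1] with [t (k-1) < s <= t k], or [0] when [s <= 0]. *)
Definition step_index t (s : R) : nat :=
  xget 0%N [set k.+1 | k in [set k | t k < s <= t k.+1]].

Definition interpolate t (x : nat -> X) (s : R) : X := x (step_index t s).

Definition converges_uniformly (sol : (nat -> R) -> (nat -> X) -> Prop)
    (T : R) xi : Prop :=
  forall eps : R, 0 < eps -> exists2 del : R, 0 < del &
    forall t (x : nat -> X), partition_of_half_line t ->
      (mesh t < del%:E)%E -> sol t x ->
      forall s : R, 0 <= s <= T -> mdist (interpolate t x s) (xi s) < eps.

(* Only the steps starting before time [H] are required to be proximal, since
   a scheme restricted to an open ball may stop existing after some time. *)
Definition discrete_solution (S : set X) phi (x0 : X) (H : \bar R)
    t (x : nat -> X) : Prop :=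
  x 0%N = x0 /\
  forall k, ((t k)%:E < H)%E ->
    prox S phi (t k.+1 - t k) (x k) (x k.+1).

Definition gradient_curve phi (z0 : X) xi : Prop :=
  (forall t : R, 0 <= t -> dom phi (xi t)) /\
  forall T : R, 0 <= T ->
    converges_uniformly (discrete_solution [set: X] phi z0 +oo%E) T xi.

(* [xi] is produced up to time [H] by the discrete scheme restricted to [S].
   Solvability of the scheme for fine partitions is part of the definition:
   on an open ball it is not automatic, and without it the convergence could
   hold vacuously. *)
Definition restricted_flow (S : set X) phi (x0 : X) (H : \bar R) xi : Prop :=
  forall T : R, 0 <= T -> (T%:E < H)%E ->
    (exists2 del : R, 0 < del &
       forall t, partition_of_half_line t -> (mesh t < del%:E)%E ->
         exists x, discrete_solution S phi x0 T%:E t x) /\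
    converges_uniformly (discrete_solution S phi x0 T%:E) T xi.

(* One stage of the local construction: started at [xi a] in the ball
   B(xi a, pi/6), which [xi] first leaves at time [b]; [b = +oo] if never. *)
Definition local_stage phi xi (a : R) (b : \bar R) : Prop :=
  let B := ball (xi a) (pi / 6) in
  [/\ (a%:E < b)%E,
      forall s : R, a <= s -> (s%:E < b)%E -> B (xi s),
      forall b' : R, b = b'%:E -> (closure B `\` interior B) (xi b') &
      restricted_flow B phi (xi a) (b - a%:E)%E (fun s => xi (a + s))].

Definition local_gradient_curve phi (z0 : X) xi : Prop :=
  [/\ xi 0 = z0,
      {within `[0, +oo[, continuous xi},
      forall t : R, 0 <= t -> dom phi (xi t) &
      exists a : nat -> \bar R,
        [/\ a 0%N = 0%E,
            forall j (r : R), a j = r%:E -> local_stage phi xi r (a j.+1),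
            forall j, a j = +oo%E -> a j.+1 = +oo%E &
            a @ \oo --> +oo%E]].

Definition CAT1_gradient_curve phi (z0 : X) xi : Prop :=
  ((diam < (pi / 2)%:E)%E -> gradient_curve phi z0 xi) /\
  (((pi / 2)%:E <= diam)%E -> local_gradient_curve phi z0 xi).

(* [zhat 0] plays no role. *)
Definition alternating_solution (phi1 phi2 : X -> \bar R) (z0 : X)
    t (zhat z : nat -> X) : Prop :=
  z 0%N = z0 /\
  forall k,
    prox [set: X] phi1 (t k.+1 - t k) (z k) (zhat k.+1) /\
    prox [set: X] phi2 (t k.+1 - t k) (zhat k.+1) (z k.+1).

(* delta^(k+1). For an alternating solution from a point of the common domain,
   the subtracted values are finite, so +oo - +oo (= -oo) never occurs. *)
Definition splitting_defect (phi1 phi2 : X -> \bar R) (zhat z : nat -> X)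
    (k : nat) : \bar R :=
  Order.max 0%E (Order.max (phi2 (zhat k.+1) - phi2 (z k))
                           (phi1 (z k.+1) - phi1 (zhat k.+1)))%E.

Definition summable_defects (phi1 phi2 : X -> \bar R) (z0 : X) : Prop :=
  forall eps T : R, 0 < eps -> 0 < T -> exists Delta : R,
    forall t (zhat z : nat -> X) (N : nat),
      partition_of_half_line t -> (mesh t < eps%:E)%E -> t N <= T ->
      alternating_solution phi1 phi2 z0 t zhat z ->
      (\sum_(0 <= k < N) splitting_defect phi1 phi2 zhat z k <= Delta%:E)%E.

End MetricSpace.

Arguments complete_space {R} X.
Arguments diam {R} X.
Arguments geodesic_space {R} X.
Arguments CAT1_space {R} X.

(* Main.v *)
Require Import Defs.
From mathcomp Require Import ring lra zify.

(** Write [d] for the distance. In both cases, whenever [z] is a proximal point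
  of [f] from [x] with step [tau], one has, for [w] close to [z],
    [d^2(z,w) <= d^2(x,w) + 2 tau (f w - f z) + L tau d^2(z,w) + C d^2(x,z)].
  It follows by comparing [z] with nearby points of a geodesic from [z] to [w],
  once the one-sided derivative of [d^2(x, .)] along that geodesic is bounded by
  [d^2(x,w) - d^2(z,w) + C d^2(x,z)]: in Case II this is commutativity plus
  K-convexity, in Case I it is spherical comparison plus the law of cosines.

  Add these inequalities for [phi1] and [phi2] along one alternating step from
  [z_k] to [z_(k+1)], tested at [x_k], to the one for [phi] along the step from
  [x_k] to [x_(k+1)] of the discrete solution on the same partition, tested at
  [z_(k+1)]. The values of [phi] telescope, so that [d^2(z_k, x_k)] grows in total
  by at most a constant times the mesh, up to an exponential factor. Hence both
  schemes have the same limit. On a [CAT(1)]-space of large diameter this is applied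
  to each local stage in turn, the alternating scheme being equi-Hoelder up to
  the mesh, which lets the convergence pass to the end point of a stage. *)

Import Order.TTheory GRing.Theory Num.Theory.
Import numFieldNormedType.Exports.
Local Open Scope classical_set_scope.
Local Open Scope ring_scope.

(** * First-order Taylor bounds for sine and cosine *)

Section TaylorTrig.
Context {R : realType}.
Implicit Types x h a b p q : R.

(** The half-angle identity reduces this to [|sin y| <= |y|]. The crude constant 1 suffices: the
    bound only serves to make cosines nonnegative on [0, 1/2]. *)
Lemma cos_ge1Bsqr x : 1 - x ^+ 2 <= cos x.
Proof.
have sin_le (y : R) : 0 <= y -> sin y <= y.
  move=> y0; have [c _] := @MVT_segment R sin cos 0 y y0
    (fun _ _ => is_derive_sin _) (continuous_subspaceT (@continuous_sin R)).
  have := cos_le1 c; rewrite sin0 !subr0 => + ->; nra.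
have sin_abs (y : R) : `|sin y| <= `|y|.
  have [y0|/ltW y0] := leP 0 y; last first.
    rewrite -(normrN y) -(normrN (sin y)) -sinN; have ny0 : 0 <= - y by rewrite oppr_ge0.
    rewrite (ger0_norm ny0) ler_norml sin_le // andbT.
    have [|/ltW] := leP (- y) 1; last by have := sin_geN1 (- y); lra.
    move=> y1; have : 0 <= sin (- y); last by lra.
    by apply: sin_ge0_pi; rewrite ny0/=; have := @pi_ge2 R; lra.
  rewrite (ger0_norm y0) ler_norml sin_le // andbT.
  have [|/ltW] := leP y 1; last by have := sin_geN1 y; lra.
  move=> y1; have : 0 <= sin y; last by lra.
  by apply: sin_ge0_pi; rewrite y0/=; have := @pi_ge2 R; lra.
have -> : cos x = 1 - 2 * sin (x / 2) ^+ 2.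
  have {1}-> : x = (x / 2) *+ 2 by rewrite -mulr_natr divfK.
  rewrite cos_mulr2n; have := cos2Dsin2 (x / 2); lra.
have := sin_abs (x / 2); rewrite -ler_sqr ?nnegrE ?normr_ge0 //.
by rewrite !real_normK ?num_real //; nra.
Qed.

Lemma cos_lipschitz x y : `|cos x - cos y| <= `|x - y|.
Proof.
wlog yx : x y / y <= x.
  move=> H; have [/H//|/ltW/H] := leP y x.
  by rewrite distrC (distrC x).
have [c _ ->] := @MVT_segment R cos (fun x => - sin x) y x yx
    (fun _ _ => is_derive_cos _) (continuous_subspaceT (@continuous_cos R)).
rewrite normrM normrN; have := sin_max c; have := normr_ge0 (x - y); nra.
Qed.

(** The mean value theorem turns the increment into [h * cos c], and the cosine, being 1-Lipschitz,
    changes by at most [|h|] between [c] and [x]. *)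
Lemma sin_taylor1 x h : `|h| <= 1 -> `|sin (x + h) - sin x - h * cos x| <= h ^+ 2.
Proof.
suff H (y k : R) : 0 <= k -> `|sin (y + k) - sin y - k * cos y| <= k ^+ 2.
  move=> _; have [/H//|/ltW h0] := leP 0 h.
  have /(H (- x)) : 0 <= - h by rewrite oppr_ge0.
  rewrite -opprD !sinN cosN sqrrN.
  by rewrite (_ : _ - _ = - (sin (x + h) - sin x - h * cos x)) ?normrN//; ring.
move=> k0; have yk : y <= y + k by rewrite lerDl.
have [c] := @MVT_segment R sin cos y (y + k) yk
    (fun _ _ => is_derive_sin _) (continuous_subspaceT (@continuous_sin R)).
rewrite in_itv/= => /andP[yc ck] ->.
rewrite [y + k]addrC addrK mulrC -mulrBr normrM (ger0_norm k0) expr2.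
rewrite ler_wpM2l // (le_trans (cos_lipschitz _ _)) // ger0_norm; lra.
Qed.

Lemma cos_taylor1 x h : `|h| <= 1 -> `|cos (x + h) - cos x + h * sin x| <= h ^+ 2.
Proof.
move=> /(sin_taylor1 (x + pi / 2)); rewrite (addrAC x) !sinDpihalf cosDpihalf.
by rewrite mulrN opprK.
Qed.

Lemma sin_ge_half p : 0 <= p <= 2^-1 -> p / 2 <= sin p <= p.
Proof.
move=> /andP[p0 p1]; have := @sin_taylor1 0 p.
rewrite add0r sin0 cos0 ger0_norm // ler_norml.
move=> /(_ _)/andP[|]; [lra|move=> h1 h2].
have [c _] := @MVT_segment R sin cos 0 p p0
    (fun _ _ => is_derive_sin _) (continuous_subspaceT (@continuous_sin R)).
have := cos_le1 c; rewrite sin0 !subr0 => + h; nra.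
Qed.

End TaylorTrig.

(** * Spherical comparison in coordinates *)

Section CAT1.
Context {R : realType}.

Definition vec3 (u v w : R) : 'rV[R]_3 := \row_(i < 3) nth 0 [:: u; v; w] i.

Lemma dot_vec3 (u v w u' v' w' : R) :
  dot (vec3 u v w) (vec3 u' v' w') = u * u' + v * v' + w * w'.
Proof. by rewrite /dot !big_ord_recl big_ord0 !mxE /= addr0 addrA. Qed.

Context {X : metricType R}.

(** On the sphere this is an equality for the comparison triangle; the CAT(1) inequality carries it
    over because the cosine decreases on [0, pi]. Sides of length at most 1 keep the perimeter below
    2 pi. *)
Lemma CAT1_cos (x y z : X) (g : R -> X) (t : R) : CAT1_space X ->
  minimal_geodesic mdist g -> g 0 = y -> g 1 = z ->
  0 < mdist y z <= 1 -> mdist x y <= 1 -> mdist x z <= 1 -> 0 <= t <= 1 ->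
  sin ((1 - t) * mdist y z) * cos (mdist x y) + sin (t * mdist y z) * cos (mdist x z)
    <= sin (mdist y z) * cos (mdist x (g t)).
Proof.
move=> [_ cat] gg g0 g1 /andP[a0 a1] p1 q1 /andP[t0 t1].
have pi2 := @pi_ge2 R.
have tri1 := metric_triangle x y z; have tri2 := metric_triangle x z y.
have tri3 := metric_triangle y x z; rewrite (metric_sym z y) in tri2.
rewrite (metric_sym y x) in tri3.
have p0 : 0 <= mdist x y := mdist_ge0 _ _; have q0 : 0 <= mdist x z := mdist_ge0 _ _.
have := cat x y z g _ gg g0 g1; rewrite (metric_sym z x).
move: (mdist y z) (mdist x y) (mdist x z) a0 a1 p0 q0 p1 q1 tri1 tri2 tri3 => a p q.
move=> a0 a1 p0 q0 p1 q1 tri1 tri2 tri3.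
have sa : 0 < sin a by apply: sin_gt0_pi; apply/andP; split; lra.
have sp : 0 <= sin p by apply: sin_ge0_pi; apply/andP; split; lra.
have in0pi (b : R) : 0 <= b -> b <= 2 -> b \in `[0, pi].
  by move=> b0 b2; rewrite in_itv/= b0 (le_trans b2).
have cq1 : cos (p + a) <= cos q.
  by rewrite leNgt ltr_cos ?in0pi -?leNgt //; lra.
have cq2 : cos q <= cos (p - a).
  rewrite -(cos_norm (p - a)) leNgt ltr_cos ?in0pi -?leNgt ?ler_norml //; try lra;
    by apply/andP; split; lra.
rewrite cosD in cq1; rewrite cosB in cq2.
(* The comparison triangle: [g'] starts at the first basis vector and runs along the great circle of
   the first two axes, and [x'] has coordinates [(cos p, v, w)]. The value [v] is forced by
   [dot x' (g' 1) = cos q]; the triangle inequalities give [|v| <= sin p], which makes [w] real. *)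
pose v := (cos q - cos p * cos a) / sin a.
have va : v * sin a = cos q - cos p * cos a by rewrite /v divfK // gt_eqF.
have vle : v ^+ 2 <= sin p ^+ 2.
  have v1 : - sin p <= v by rewrite -(ler_pM2r sa) va; lra.
  have v2 : v <= sin p by rewrite -(ler_pM2r sa) va; lra.
  nra.
have cs (b : R) : cos b ^+ 2 + sin b ^+ 2 = 1 := cos2Dsin2 b.
pose w := Num.sqrt (sin p ^+ 2 - v ^+ 2).
have w2 : w ^+ 2 = sin p ^+ 2 - v ^+ 2 by rewrite sqr_sqrtr // subr_ge0.
pose x' := vec3 (cos p) v w.
pose g' s := vec3 (cos (s * a)) (sin (s * a)) 0.
have sg s : @sphere R (g' s) by rewrite /sphere/= dot_vec3; have := cs (s * a); lra.
have sx : @sphere R x' by rewrite /sphere/= dot_vec3; have := cs p; lra.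
have dg (s s' : R) : 0 <= s <= 1 -> 0 <= s' <= 1 ->
    @sphere_dist R (g' s) (g' s') = `|s - s'| * a.
  move=> /andP[? ?] /andP[? ?].
  rewrite /sphere_dist dot_vec3 mulr0 addr0 -cosB -mulrBl -cos_norm cosK.
    by rewrite normrM (gtr0_norm a0).
  rewrite normrM (gtr0_norm a0); have := normr_ge0 (s - s').
  have : `|s - s'| <= 1 by rewrite ler_norml; apply/andP; split; lra.
  by move=> ? ?; apply: in0pi; nra.
have gg' : minimal_geodesic (@sphere_dist R) g'.
  by move=> s s' hs hs'; rewrite !dg ?lexx ?ler01 // sub0r normrN1 mul1r.
have dxy : @sphere_dist R x' (g' 0) = p.
  rewrite /sphere_dist dot_vec3 mul0r cos0 sin0 !mulr0 !addr0 mulr1 cosK //.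
  by apply: in0pi; lra.
have dxz : @sphere_dist R (g' 1) x' = q.
  rewrite /sphere_dist dot_vec3 mul1r mul0r addr0 -[X in acos X](_ : cos q = _) ?cosK //.
    by apply: in0pi; lra.
  by have := va; lra.
have dyz : @sphere_dist R (g' 0) (g' 1) = a.
  by rewrite dg ?lexx ?ler01 // sub0r normrN1 mul1r.
have per : p + a + q < 2 * pi by lra.
move=> /(_ per x' (g' 0) (g' 1) g' sx (sg _) (sg _) dxy dyz dxz (fun _ _ => sg _) gg').
move=> /(_ erefl erefl t); rewrite t0 t1 => /(_ isT) dle.
pose D := cos p * cos (t * a) + v * sin (t * a).
have De : dot (x') (g' t) = D by rewrite dot_vec3 mulr0 addr0.
(* Cauchy-Schwarz, through Lagrange's identity; it makes [D] the cosine of [acos D]. *)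
have D1 : -1 <= D <= 1.
  rewrite -ler_norml -(@ler_pXn2r _ 2) ?nnegrE ?normr_ge0 ?ler01 //.
  rewrite real_normK ?num_real // expr1n.
  rewrite /D; have := cs (t * a); have := cs p; move: (cos (t * a)) (sin (t * a)) => c s e1 e2.
  have : (cos p * c + v * s) ^+ 2 + (cos p * s - v * c) ^+ 2 =
      (cos p ^+ 2 + v ^+ 2) * (c ^+ 2 + s ^+ 2) by ring.
  rewrite e2 mulr1 => e3; have := sqr_ge0 (cos p * s - v * c); lra.
have Dc : D <= cos (mdist x (g t)).
  rewrite /sphere_dist De in dle.
  have -> : D = cos (acos D) by rewrite acosK // in_itv.
  rewrite leNgt ltr_cos ?in_itv/= ?mdist_ge0 ?acos_ge0 ?acos_lepi //= -?leNgt //.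
  exact: le_trans dle (acos_lepi D1).
rewrite -(ler_pM2l sa) in Dc; apply: le_trans Dc.
rewrite mulrBl mul1r sinB le_eqVlt; apply/orP; left; apply/eqP.
transitivity (sin a * cos (t * a) * cos p + sin (t * a) * (cos q - cos p * cos a)).
  by ring.
by rewrite -va /D; ring.
Qed.

(** Apply [CAT1_cos] with vertex [h t]: by the addition formula its left side is [sin a], which
    forces [cos (mdist (h t) (g t)) >= 1]. The convexity of [phi1] and that of [phi2] may come with
    different geodesics; uniqueness makes them one. *)
Lemma CAT1_short_geodesic_unique (g h : R -> X) (t : R) : CAT1_space X ->
  minimal_geodesic mdist g -> minimal_geodesic mdist h ->
  g 0 = h 0 -> g 1 = h 1 -> mdist (g 0) (g 1) <= 2^-1 -> 0 <= t <= 1 ->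
  g t = h t.
Proof.
move=> cat gg hh e0 e1 d1 /andP[t0 t1]; set a := mdist (g 0) (g 1) in d1.
have hp : mdist (h t) (g 0) = t * a.
  by rewrite e0 hh ?t0 ?t1 ?lexx ?ler01 //= subr0 ger0_norm // -e0 -e1.
have hq : mdist (h t) (g 1) = (1 - t) * a.
  rewrite e1 hh ?t0 ?t1 ?lexx ?ler01 //= -e0 -e1 distrC ger0_norm //; lra.
have gp : mdist (g t) (g 0) = t * a.
  by rewrite gg ?t0 ?t1 ?lexx ?ler01 //= subr0 ger0_norm.
have a0 : 0 <= a := mdist_ge0 _ _.
apply: mdist_positivity.
have [a00|an0] := eqVneq a 0.
  apply/eqP; rewrite eq_le mdist_ge0 andbT.
  have := metric_triangle (g t) (g 0) (h t).
  by rewrite gp metric_sym [mdist (g 0) _]metric_sym hp a00; lra.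
have {an0} a0' : 0 < a by rewrite lt_neqAle eq_sym an0.
have := @CAT1_cos (h t) (g 0) (g 1) g t cat gg erefl erefl.
rewrite -/a hp hq a0' t0 t1 (le_trans d1) /=; last by lra.
have -> : t * a <= 1 by nra.
have -> : (1 - t) * a <= 1 by nra.
move=> /(_ isT isT isT isT); rewrite [sin (t * a) * _]mulrC -sinD -mulrDl subrK mul1r.
have pi2 := @pi_ge2 R.
have sa : 0 < sin a by apply: sin_gt0_pi; apply/andP; split; lra.
rewrite ler_pMr // -cos0 leNgt => /negP cl.
rewrite metric_sym; apply/eqP; rewrite eq_le mdist_ge0 andbT leNgt.
apply/negP => d0; apply: cl; rewrite ltr_cos // in_itv/= ?lexx ?pi_ge0 //.
rewrite mdist_ge0/=; have := metric_triangle (h t) (g 0) (g t).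
by rewrite hp [mdist (g 0) _]metric_sym gp; nra.
Qed.

End CAT1.

(** * First variation of the squared distance *)

Section FirstVariation.
Context {R : realType}.

(** In a spherical triangle whose sides [b] and [p] enclose an angle theta opposite to [c], the left
    side is [-2 p b cos theta]. In the plane this would be [c^2 - b^2 - p^2]; on the sphere the
    excess over [c^2 - b^2] is still at most of order [p^2]. *)
Lemma cosine_law_bound (b p c : R) : 0 < b <= 2^-1 -> 0 < p <= 2^-1 -> `|c - b| <= p ->
  2 * (p / sin p) * (b / sin b) * (cos b * cos p - cos c) <=
    c ^+ 2 - b ^+ 2 + 12 * p ^+ 2.
Proof.
move=> /andP[b0 b1] /andP[p0 p1] cb.
have /andP[sp1 sp2] : p / 2 <= sin p <= p by apply: sin_ge_half; rewrite (ltW p0).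
have /andP[sb1 sb2] : b / 2 <= sin b <= b by apply: sin_ge_half; rewrite (ltW b0).
have sp0 : 0 < sin p by lra.
have sb0 : 0 < sin b by lra.
set A := p / sin p; set B := b / sin b.
have A1 : 1 <= A by rewrite ler_pdivlMr // mul1r.
have A2 : A - 1 <= 2 * p.
  have := @sin_taylor1 R 0 p; rewrite add0r sin0 cos0 gtr0_norm // ler_norml.
  move=> /(_ _)/andP[|h1 _]; first lra.
  by rewrite lerBlDr ler_pdivrMr //; nra.
have B0 : 0 <= B <= 2.
  by rewrite divr_ge0 ?(ltW b0) ?(ltW sb0) //= ler_pdivrMr //; lra.
have Bs : B * sin b = b by rewrite divfK // gt_eqF.
have cosb : 0 <= cos b by have := cos_ge1Bsqr b; nra.
have W : cos b * cos p - cos c <= cos b - cos c.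
  by rewrite lerB // ler_piMr // cos_le1.
have u1 : cos b - cos c <= p.
  by have := ler_norm (cos b - cos c); have := cos_lipschitz b c; rewrite [`|b - c|]distrC; lra.
have u2 : cos b - cos c <= (c - b) * sin b + (c - b) ^+ 2.
  have /(@cos_taylor1 R b) : `|c - b| <= 1 by lra.
  by rewrite subrKC ler_norml => /andP[? _]; lra.
have h2 : (c - b) ^+ 2 <= p ^+ 2.
  by rewrite -(real_normK (num_real _)) ler_pXn2r ?nnegrE // ltW.
move: W u1 u2; set W := _ - cos c; set u := _ - cos c => Wu u1 u2.
have AB0 : 0 <= 2 * A * B by nra.
apply: (le_trans (ler_wpM2l AB0 Wu)).
(* In the part with [A] replaced by 1, [B * sin b = b] turns the expansion of [u] into
   [2 (c - b) b <= c^2 - b^2] with error [4 p^2]; the remainder [A - 1 <= 2 p] costs at most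
   [8 p^2], whence the constant 12. *)
have -> : 2 * A * B * u = 2 * B * u + 2 * (A - 1) * B * u by ring.
have e1 : 2 * B * u <= 2 * (c - b) * b + 4 * p ^+ 2.
  apply: (@le_trans _ _ (2 * B * ((c - b) * sin b + (c - b) ^+ 2))).
    by apply: ler_wpM2l => //; lra.
  have -> : 2 * B * ((c - b) * sin b + (c - b) ^+ 2) =
      2 * (c - b) * (B * sin b) + 2 * (B * (c - b) ^+ 2) by ring.
  have : B * (c - b) ^+ 2 <= 2 * p ^+ 2.
    by case/andP: B0 => *; apply: ler_pM => //; exact: sqr_ge0.
  rewrite Bs; lra.
have e2 : 2 * (A - 1) * B * u <= 8 * p ^+ 2.
  have [u0|/ltW u0] := leP u 0.
    have := sqr_ge0 p; have : 0 <= (A - 1) * B by nra.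
    nra.
  have t1 : (A - 1) * B <= 2 * p * 2 by apply: ler_pM; lra.
  have t2 : (A - 1) * B * u <= 2 * p * 2 * p by apply: ler_pM => //; nra.
  lra.
have := sqr_ge0 (c - b); lra.
Qed.

(** First-order expansion in [s] of the inequality of [CAT1_cos], with [D] the distance from [x] to
    the point at time [s]. The coefficient of [s] is the quantity bounded in [cosine_law_bound]; [K]
    collects the second-order terms, uniformly in [s] and [D]. *)
Lemma spherical_first_variation (b p c : R) :
  0 < b <= 2^-1 -> 0 < p <= 2^-1 -> `|c - b| <= p ->
  exists K, forall s D, 0 <= s <= 1 -> `|D - p| <= s * b ->
    sin ((1 - s) * b) * cos p + sin (s * b) * cos c <= sin b * cos D ->
    D ^+ 2 - p ^+ 2 <= s * (c ^+ 2 - b ^+ 2 + 12 * p ^+ 2) + s ^+ 2 * K.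
Proof.
move=> b01 p01 cb; have law := cosine_law_bound _ _ _ b01 p01 cb.
move: b01 p01 => /andP[b0 b1] /andP[p0 p1].
have /andP[sp1 sp2] : p / 2 <= sin p <= p by apply: sin_ge_half; rewrite (ltW p0).
have /andP[sb1 sb2] : b / 2 <= sin b <= b by apply: sin_ge_half; rewrite (ltW b0).
have sp0 : 0 < sin p by lra.
have sb0 : 0 < sin b by lra.
(* Three errors of size [s^2 b^2] get divided by [sin p * sin b] and multiplied by [2 p]; the last
   [b^2] comes from [(D - p)^2]. *)
exists (2 * p * (3 * b ^+ 2 / (sin p * sin b)) + b ^+ 2) => s D /andP[s0 s1] Dp cat.
have sb01 : 0 <= s * b <= 1 by nra.
have h1 : `|D - p| <= 1 by lra.
have h2 : (D - p) ^+ 2 <= s ^+ 2 * b ^+ 2.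
  rewrite -exprMn -(real_normK (num_real _)) ler_pXn2r ?nnegrE //.
  by case/andP: sb01.
have t1 : cos D <= cos p - (D - p) * sin p + (D - p) ^+ 2.
  have := cos_taylor1 p _ h1; rewrite subrKC ler_norml => /andP[_ ?]; lra.
have t2 : sin b - s * b * cos b - s ^+ 2 * b ^+ 2 <= sin ((1 - s) * b).
  have /(sin_taylor1 b) : `|- (s * b)| <= 1 by rewrite normrN ger0_norm; lra.
  rewrite ler_norml mulNr sqrrN exprMn opprK mulrBl mul1r => /andP[? _]; lra.
have t3 : `|sin (s * b) - s * b| <= s ^+ 2 * b ^+ 2.
  have /(sin_taylor1 0) : `|s * b| <= 1 by rewrite ger0_norm; lra.
  by rewrite add0r sin0 subr0 cos0 mulr1 exprMn.
have cosp : 0 <= cos p <= 1 by rewrite cos_le1 andbT; have := cos_ge1Bsqr p; nra.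
have q1 : (sin b - s * b * cos b - s ^+ 2 * b ^+ 2) * cos p <= sin ((1 - s) * b) * cos p.
  by apply: ler_wpM2r => //; lra.
have q2 : s * b * cos c - s ^+ 2 * b ^+ 2 <= sin (s * b) * cos c.
  have : `|(sin (s * b) - s * b) * cos c| <= s ^+ 2 * b ^+ 2 * 1.
    by rewrite normrM; apply: ler_pM => //; exact: cos_max.
  by rewrite ler_norml mulr1 => /andP[? _]; lra.
have q3 : sin b * cos D <= sin b * (cos p - (D - p) * sin p + (D - p) ^+ 2).
  by apply: ler_wpM2l => //; exact: ltW.
have sb22 : 0 <= s ^+ 2 * b ^+ 2 by rewrite mulr_ge0 ?sqr_ge0.
have q4 : s ^+ 2 * b ^+ 2 * cos p <= s ^+ 2 * b ^+ 2 by rewrite ler_piMr //; case/andP: cosp.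
have q5 : sin b * (D - p) ^+ 2 <= s ^+ 2 * b ^+ 2.
  by rewrite -[leRHS]mul1r; apply: ler_pM => //; rewrite ?sqr_ge0 ?(ltW sb0) //; exact: sin_le1.
set W := cos b * cos p - cos c in law.
have main : (D - p) * (sin p * sin b) <= s * b * W + 3 * (s ^+ 2 * b ^+ 2).
  rewrite /W; lra.
have spb : 0 < sin p * sin b by rewrite mulr_gt0.
have main2 : D - p <= (s * b * W + 3 * (s ^+ 2 * b ^+ 2)) / (sin p * sin b).
  by rewrite ler_pdivlMr.
have main3 : 2 * p * (D - p) <= s * (2 * (p / sin p) * (b / sin b) * W) +
    s ^+ 2 * (2 * p * (3 * b ^+ 2 / (sin p * sin b))).
  have p20 : 0 <= 2 * p by lra.
  apply: le_trans (ler_wpM2l p20 main2) _.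
  rewrite le_eqVlt; apply/orP; left; apply/eqP; field.
  by rewrite !gt_eqF.
have := ler_wpM2l s0 law.
have -> : D ^+ 2 - p ^+ 2 = 2 * p * (D - p) + (D - p) ^+ 2 by ring.
lra.
Qed.

Context {X : metricType R}.

(** An upper bound for the right derivative at 0 of the squared distance from [x] along [g], written
    with an error [e] so as not to presuppose differentiability. *)
Definition first_variation_bound (C : R) (x : X) (g : R -> X) : Prop :=
  forall e : R, 0 < e -> exists2 s0 : R, 0 < s0 & forall s, 0 < s < s0 ->
    mdist x (g s) ^+ 2 - mdist x (g 0) ^+ 2 <=
      s * (mdist x (g 1) ^+ 2 - mdist (g 0) (g 1) ^+ 2
           + C * mdist x (g 0) ^+ 2 + e).

Lemma CAT1_first_variation (x : X) (g : R -> X) : CAT1_space X ->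
  minimal_geodesic mdist g -> mdist (g 0) (g 1) <= 2^-1 -> mdist x (g 0) <= 2^-1 ->
  first_variation_bound 12 x g.
Proof.
move=> cat gg b1 p1 e e0.
set b := mdist (g 0) (g 1) in b1 *; set p := mdist x (g 0) in p1 *.
set c := mdist x (g 1).
have gs s : 0 <= s <= 1 -> mdist (g 0) (g s) = s * b.
  move=> s01; rewrite gg ?lexx ?ler01 // sub0r normrN ger0_norm //.
  by case/andP: s01.
have b0 : 0 <= b := mdist_ge0 _ _; have p0 : 0 <= p := mdist_ge0 _ _.
have Dp s : 0 <= s <= 1 -> `|mdist x (g s) - p| <= s * b.
  move=> s01; rewrite ler_norml.
  have := metric_triangle x (g 0) (g s); have := metric_triangle x (g s) (g 0).
  by rewrite [mdist (g s) (g 0)]metric_sym !gs // -/p; lra.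
have cb : `|c - b| <= p.
  rewrite ler_norml; have := metric_triangle x (g 0) (g 1).
  by have := metric_triangle (g 0) x (g 1); rewrite [mdist _ x]metric_sym -/p -/c -/b; lra.
have [b00|bn0] := eqVneq b 0.
  exists 1 => // s /andP[s0 s1].
  have := Dp s; rewrite b00 mulr0 normr_le0 subr_eq0 (ltW s0) (ltW s1).
  move=> /(_ isT)/eqP ->; rewrite subrr mulr_ge0 ?(ltW s0) //.
  by rewrite expr0n/= subr0; have := sqr_ge0 c; have := sqr_ge0 p; lra.
have {}b0 : 0 < b by rewrite lt_neqAle eq_sym bn0.
(* If [x = g 0], division by [sin p] is impossible, but the squared distance is then at most
   [s^2 b^2], of second order. *)
have [p00|pn0] := eqVneq p 0.
  exists (Num.min 1 e) => [|s]; first by rewrite lt_min ltr01.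
  rewrite lt_min => /and3P[s0 s1 se]; have s01 : 0 <= s <= 1 by rewrite !ltW.
  have := Dp s s01; rewrite p00 !subr0 ger0_norm ?mdist_ge0 // => D.
  have -> : c = b.
    by apply/eqP; rewrite -subr_eq0 -normr_le0 (le_trans cb) // p00.
  rewrite expr0n/= mulr0 subrr !add0r subr0.
  have : mdist x (g s) ^+ 2 <= (s * b) ^+ 2.
    by rewrite ler_pXn2r ?nnegrE ?mdist_ge0 // mulr_ge0 // ltW.
  have : b ^+ 2 <= 1 by nra.
  have : 0 <= s ^+ 2 by rewrite sqr_ge0.
  by rewrite exprMn; nra.
have {}p0 : 0 < p by rewrite lt_neqAle eq_sym pn0.
have b01 : 0 < b <= 2^-1 by rewrite b0.
have p01 : 0 < p <= 2^-1 by rewrite p0.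
have [K HK] := spherical_first_variation _ _ _ b01 p01 cb.
have K0 : 0 < `|K| + 1 by rewrite ltr_wpDl.
exists (Num.min 1 (e / (`|K| + 1))) => [|s]; first by rewrite lt_min ltr01 divr_gt0.
rewrite lt_min => /and3P[s0 s1]; rewrite ltr_pdivlMr // => sK.
have s01 : 0 <= s <= 1 by rewrite !ltW.
have := HK s (mdist x (g s)) s01 (Dp s s01).
have := CAT1_cos x _ _ _ s cat gg erefl erefl.
rewrite -/b -/p -/c b0 s01 /= => H1 H2.
have c1 : c <= 1 by move: cb; rewrite ler_norml => /andP[_]; lra.
have {}H1 := H1 _ _ c1 isT; have {H1}H2 := H2 (H1 _ _).
apply: le_trans (H2 _ _) _; [lra..|].
have : s ^+ 2 * K <= s * e.
  by rewrite expr2 -mulrA ler_wpM2l ?(ltW s0) //; have := ler_norm K; nra.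
lra.
Qed.
End FirstVariation.

(** * The commutative case, and the variational inequality of a proximal step *)

Section Setting.
Context {R : realType} {X : metricType R}.

Lemma near_at_right0P (P : R -> Prop) : (\forall s \near 0^'+, P s) ->
  exists2 s0 : R, 0 < s0 & forall s, 0 < s < s0 -> P s.
Proof.
move=> /nbhs_ballP[e /= e0 He]; exists e => // s /andP[s0 se].
by apply: He => //=; rewrite /ball/= sub0r normrN gtr0_norm.
Qed.

(** Commutativity trades the derivative along [g] of the squared distance to [x] for the derivative
    along [h], which runs towards [x], of the squared distance to [g 1]; there K-convexity bounds
    the difference quotients. *)
Lemma commutative_first_variation (K : R) (Gamma : set (R -> X)) (x : X) (g h : R -> X) :
  K_convex_sqdist K Gamma -> commutative_along Gamma ->
  Gamma g -> Gamma h -> h 0 = g 0 -> h 1 = x ->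
  first_variation_bound (`|K| / 2) x g.
Proof.
move=> Kc comm Gg Gh h0 h1 e e0.
have [l [l1 l2]] := comm g h Gg Gh (esym h0).
set M := mdist x (g 1) ^+ 2 - mdist (g 0) (g 1) ^+ 2 + `|K| / 2 * mdist x (g 0) ^+ 2.
have lM : l <= M.
  rewrite -(cvg_lim _ l2) //; apply: limr_le; first by apply/cvg_ex; exists l.
  near=> s.
  have s0 : 0 < s by near: s; exact: nbhs_right_gt.
  have s1 : s < 1 by near: s; exact: nbhs_right_lt.
  rewrite ler_pdivrMr //.
  have := Kc (g 1) h Gh s; rewrite (ltW s0) (ltW s1) => /(_ isT).
  rewrite metric_sym h0 h1 ![mdist (g 1) _]metric_sym [mdist (g 0) x]metric_sym /M.
  have : - (K * (1 - s)) <= `|K|.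
    rewrite -mulrN; apply: le_trans (ler_norm _) _; rewrite normrM normrN.
    by rewrite ler_piMr // ger0_norm; lra.
  have : 0 <= s * mdist x (g 0) ^+ 2 by rewrite mulr_ge0 ?sqr_ge0 ?ltW.
  nra.
have /near_at_right0P[s0 s00 Hs] : \forall s \near 0^'+,
    (mdist (g s) (h 1) ^+ 2 - mdist (g 0) (h 1) ^+ 2) / s <= M + e.
  have Me : l < M + e by lra.
  by near=> s; apply/ltW; near: s; exact: (cvgr_lt _ l1).
exists s0 => // s ss; have := Hs s ss; rewrite h1 ler_pdivrMr ?(andP ss).1 //.
by rewrite ![mdist x _]metric_sym /M [X in _ -> _ <= X]mulrC ![mdist x _]metric_sym.
Unshelve. all: by end_near. Qed.

(** The minimizer [z] is tested against [g s]: convexity bounds [f (g s)], the first variation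
    bounds the distance term, and division by [s] leaves the claim up to [e]. Openness of [S] makes
    [g s] admissible for small [s]. *)
Lemma prox_EVI (S : set X) (f : X -> \bar R) (lambda C tau fz fw : R)
    (x z w : X) (g : R -> X) :
  open S -> 0 < tau -> prox S f tau x z ->
  minimal_geodesic mdist g -> g 0 = z -> g 1 = w ->
  f z = fz%:E -> f w = fw%:E -> convex_along f lambda g ->
  first_variation_bound C x g ->
  mdist z w ^+ 2 <= mdist x w ^+ 2 + 2 * tau * (fw - fz)
    + `|lambda| * tau * mdist z w ^+ 2 + C * mdist x z ^+ 2.
Proof.
move=> oS tau0 [Sz zinf] gg g0 g1 fzE fwE conv var.
apply/ler_addgt0Pl => e e0.
have [s0 s00 Hs0] := var e e0.
have /nbhs_ballP[r /= r0 Br] := open_nbhs_nbhs (conj oS Sz).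
have b0 : 0 <= mdist z w := mdist_ge0 _ _.
have [s /and4P[sp s1 ss0 sr]] : exists s, [&& 0 < s, s < 1, s < s0 & s * mdist z w < r].
  exists (Num.min (s0 / 2) (Num.min (2^-1) (r / (mdist z w + 1)) / 2)).
  set q := r / _; have q0 : 0 < q by rewrite divr_gt0 // ltr_wpDl.
  have qb : q * (mdist z w + 1) = r by rewrite divfK // gt_eqF // ltr_wpDl.
  have m1 : Num.min 2^-1 q <= 2^-1 by rewrite ge_min lexx.
  have m2 : Num.min 2^-1 q <= q by rewrite ge_min lexx orbT.
  have m0 : 0 < Num.min 2^-1 q by rewrite lt_min q0 andbT; lra.
  move: m0 m1 m2; set m := Num.min 2^-1 q => m0 m1 m2.
  have n1 : Num.min (s0 / 2) (m / 2) <= s0 / 2 by rewrite ge_min lexx.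
  have n2 : Num.min (s0 / 2) (m / 2) <= m / 2 by rewrite ge_min lexx orbT.
  have n0 : 0 < Num.min (s0 / 2) (m / 2) by rewrite lt_min; apply/andP; split; lra.
  move: n0 n1 n2; set n := Num.min (s0 / 2) (m / 2) => n0 n1 n2.
  by apply/and4P; split; [lra|lra|lra|nra].
have s01 : 0 <= s <= 1 by rewrite !ltW.
have Sg : S (g s).
  apply: Br; rewrite ballEmdist/= -{1}g0 gg ?lexx ?ler01 // sub0r normrN gtr0_norm //.
  by rewrite g0 g1.
have h1 : (f z + (mdist x z ^+ 2 / (2 * tau))%:E <=
    f (g s) + (mdist x (g s) ^+ 2 / (2 * tau))%:E)%E.
  by rewrite zinf; apply: ereal_inf_lbound; exists (g s).
have h2 : (f (g s) <= ((1 - s) * fz + s * fw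
    - lambda / 2 * (1 - s) * s * mdist z w ^+ 2)%:E)%E.
  by have := conv s s01; rewrite g0 g1 fzE fwE.
have := le_trans h1 (leeD2r _ h2); rewrite fzE -!EFinD lee_fin => {h1 h2} h.
have s0' : 0 < s < s0 by rewrite sp.
have := Hs0 s s0'; rewrite g0 g1 => v.
have t2 : 0 < 2 * tau by lra.
have {h} := ler_wpM2r (ltW t2) h.
rewrite mulrDl divfK ?gt_eqF // [leRHS]mulrDl divfK ?gt_eqF // => h.
have lam : - (lambda * (1 - s)) <= `|lambda|.
  rewrite -mulrN; apply: le_trans (ler_norm _) _; rewrite normrM normrN.
  by rewrite ler_piMr // ger0_norm; lra.
have {lam} : - (lambda * (1 - s)) * (tau * mdist z w ^+ 2) <=
    `|lambda| * (tau * mdist z w ^+ 2).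
  by rewrite ler_wpM2r // mulr_ge0 ?sqr_ge0 // ltW.
move=> lam.
rewrite -(ler_pM2l sp).
have := ler_wpM2l (ltW sp) lam; lra.
Qed.

End Setting.

(** * One step of the schemes *)

Section Steps.
Context {R : realType} {X : metricType R}.
Implicit Types (f phi : X -> \bar R).

Lemma dom_fineK f x : (-oo < f x)%E -> dom f x -> (fine (f x))%:E = f x.
Proof. by rewrite /dom/=; case: (f x). Qed.

Lemma dom_le f x r : (f x <= r%:E)%E -> dom f x.
Proof. by rewrite /dom/= => + fx; rewrite fx leye_eq. Qed.

Lemma prox_le (S : set X) f (tau : R) x z w : prox S f tau x z -> S w ->
  (f z + (mdist x z ^+ 2 / (2 * tau))%:E <= f w + (mdist x w ^+ 2 / (2 * tau))%:E)%E.
Proof. by move=> [_ ->] Sw; apply: ereal_inf_lbound; exists w. Qed.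

(** Minimality is tested with the competitor [x] itself, whose distance term vanishes. *)
Lemma prox_energy (S : set X) f (tau : R) x z : (-oo < f x)%E -> (-oo < f z)%E ->
  0 < tau -> prox S f tau x z -> S x -> dom f x ->
  dom f z /\ mdist x z ^+ 2 <= 2 * tau * (fine (f x) - fine (f z)).
Proof.
move=> fx fz t0 pr Sx dx; have := prox_le _ _ _ _ _ _ pr Sx.
rewrite -(dom_fineK f x) // mdistxx expr0n/= mul0r adde0.
case E: (f z) fz => [r| |] //= _.
rewrite -EFinD lee_fin => h; split; first by rewrite /dom/= E.
have t2 : 0 < 2 * tau by rewrite mulr_gt0.
have := ler_wpM2l (ltW t2) h; rewrite mulrDr mulrCA divff ?gt_eqF //; lra.
Qed.

Context (phi1 phi2 : X -> \bar R).

Lemma sum_gtNy x : (-oo < phi1 x)%E -> (-oo < phi2 x)%E -> (-oo < (phi1 \+ phi2) x)%E.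
Proof.
rewrite /=; case: (phi1 x) => [a||]; case: (phi2 x) => [b||]; rewrite ?ltxx // => _ _.
exact: ltNyr.
Qed.

(* The closeness bound [1/2] keeps all comparison triangles small in Case I; it is
   superfluous in Case II. *)
Definition regular_geodesics (lambda1 lambda2 C : R) : Prop :=
  forall x z w : X, dom phi1 z -> dom phi2 z -> dom phi1 w -> dom phi2 w ->
    mdist z w <= 2^-1 -> mdist x z <= 2^-1 ->
    exists g : R -> X, [/\ minimal_geodesic mdist g, g 0 = z, g 1 = w,
      convex_along phi1 lambda1 g /\ convex_along phi2 lambda2 g &
      first_variation_bound C x g].

Lemma CAT1_regular lambda1 lambda2 : CAT1_space X ->
  lambda_convex phi1 lambda1 -> lambda_convex phi2 lambda2 ->
  regular_geodesics lambda1 lambda2 12.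
Proof.
move=> cat c1 c2 x z w z1 z2 w1 w2 zw xz.
have [g [gg g0 g1 cg]] := c1 z w z1 w1.
have [h [hh h0 h1 ch]] := c2 z w z2 w2.
exists g; split => //; last by apply: CAT1_first_variation => //; rewrite g0 ?g1.
split => // t t01.
have e s : 0 <= s <= 1 -> g s = h s.
  by move=> s01; apply: CAT1_short_geodesic_unique => //; rewrite ?g0 ?g1 ?h0 ?h1.
by have := ch t t01; rewrite -!e ?lexx ?ler01.
Qed.

Lemma commutative_regular lambda1 lambda2 :
  commutative_K_convex_setting phi1 phi2 lambda1 lambda2 ->
  exists2 C, 0 <= C & regular_geodesics lambda1 lambda2 C.
Proof.
move=> [K [Gamma [gG exG [c1 c2] Kc comm]]].
exists (`|K| / 2); first by rewrite divr_ge0.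
move=> x z w z1 z2 w1 w2 _ _.
have [g Gg [g0 g1]] := exG z w; have [h Gh [h0 h1]] := exG z x.
exists g; split => //.
- exact: gG.
- by split; [apply: c1|apply: c2]; rewrite ?g0 ?g1.
- by apply: (commutative_first_variation K Gamma x g h) => //; rewrite g0.
Qed.

Context (lambda1 lambda2 C L : R).
Hypothesis phi1_gtNy : forall x, (-oo < phi1 x)%E.
Hypothesis phi2_gtNy : forall x, (-oo < phi2 x)%E.
Hypothesis reg : regular_geodesics lambda1 lambda2 C.
Hypothesis L1 : `|lambda1| <= L.
Hypothesis L2 : `|lambda2| <= L.

Let L0 : 0 <= L.
Proof. exact: le_trans (normr_ge0 _) L1. Qed.

Definition finite_dom : set X := dom phi1 `&` dom phi2.
(** Since [fine] sends infinite values to 0, these real values are meaningful only on the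
    domains. *)
Definition value1 x := fine (phi1 x).
Definition value2 x := fine (phi2 x).
Definition value x := value1 x + value2 x.
Local Notation D := finite_dom.
Local Notation F1 := value1.
Local Notation F2 := value2.
Local Notation F := value.

Lemma sum_fineE x : D x -> (phi1 \+ phi2)%E x = (F x)%:E.
Proof. by move=> [d1 d2]; rewrite /value EFinD !dom_fineK. Qed.

Lemma dom_sum x : dom (phi1 \+ phi2)%E x <-> D x.
Proof.
split=> [|Dx]; last by rewrite /dom/= sum_fineE.
move: (phi1_gtNy x) (phi2_gtNy x); rewrite /finite_dom /dom/=.
by case: (phi1 x) => [a||]; case: (phi2 x) => [b||].
Qed.

(** The inequalities of the two half steps, both tested at [w], are added: the leading
    [mdist zh w ^+ 2] cancels, and [F1 zh] is exchanged for [F1 z'] at the price of [delta]. The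
    bounds 1/4 keep all distances within the range 1/2 of [regular_geodesics]. *)
Lemma alternating_step (tau delta : R) (z zh z' w : X) : 0 < tau <= 1 ->
  prox [set: X] phi1 tau z zh -> prox [set: X] phi2 tau zh z' ->
  D zh -> D z' -> D w ->
  mdist z zh <= 4^-1 -> mdist zh z' <= 4^-1 -> mdist z' w <= 4^-1 ->
  F1 z' - F1 zh <= delta ->
  mdist z' w ^+ 2 <= mdist z w ^+ 2 + 2 * tau * (F w - F z')
    + 3 * L * tau * mdist z' w ^+ 2 + 2 * tau * delta
    + (C + 2 * L) * (mdist z zh ^+ 2 + mdist zh z' ^+ 2).
Proof.
move=> /andP[t0 t1] p1 p2 [zh1 zh2] [z1 z2] [w1 w2] d1 d2 d3 del.
have tri := metric_triangle zh z' w.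
have [||g [gg g0 g1 [cg _] vg]] := reg z zh w zh1 zh2 w1 w2; [lra..|].
have [||h [hh h0 h1 [_ ch] vh]] := reg zh z' w z1 z2 w1 w2; [lra..|].
have := @prox_EVI R X _ _ _ _ _ (F1 zh) (F1 w) _ _ _ _ openT t0 p1 gg g0 g1 _ _ cg vg.
rewrite !dom_fineK // => /(_ erefl erefl) e1.
have := @prox_EVI R X _ _ _ _ _ (F2 z') (F2 w) _ _ _ _ openT t0 p2 hh h0 h1 _ _ ch vh.
rewrite !dom_fineK // => /(_ erefl erefl) e2.
have sq : mdist zh w ^+ 2 <= 2 * mdist z' w ^+ 2 + 2 * mdist zh z' ^+ 2.
  have : mdist zh w ^+ 2 <= (mdist zh z' + mdist z' w) ^+ 2.
    by rewrite ler_pXn2r ?nnegrE ?addr_ge0 ?mdist_ge0.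
  have := sqr_ge0 (mdist zh z' - mdist z' w); lra.
have Lt : 0 <= L * tau by rewrite mulr_ge0 // ltW.
have k1 : `|lambda1| * tau * mdist zh w ^+ 2 <=
    L * tau * (2 * mdist z' w ^+ 2 + 2 * mdist zh z' ^+ 2).
  apply: ler_pM => //; rewrite ?sqr_ge0 ?mulr_ge0 ?(ltW t0) //.
  by rewrite ler_wpM2r // ltW.
have k2 : `|lambda2| * tau * mdist z' w ^+ 2 <= L * tau * mdist z' w ^+ 2.
  by rewrite ler_wpM2r ?sqr_ge0 // ler_wpM2r // ltW.
have k3 : L * tau * mdist zh z' ^+ 2 <= L * (mdist z zh ^+ 2 + mdist zh z' ^+ 2).
  apply: ler_pM => //; rewrite ?sqr_ge0 //; last by rewrite lerDr sqr_ge0.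
  by rewrite -[leRHS]mulr1 ler_wpM2l.
have k4 : 2 * tau * (F1 z' - F1 zh) <= 2 * tau * delta by rewrite ler_wpM2l //; lra.
rewrite /value; lra.
Qed.

(** Both functionals are convex along one common geodesic, so their sum is convex along it with
    constant [lambda1 + lambda2], and [prox_EVI] applies to it. *)
Lemma sum_prox_step (S : set X) (tau : R) (x x' v : X) : open S -> 0 < tau ->
  prox S (phi1 \+ phi2)%E tau x x' -> D x' -> D v ->
  mdist x x' <= 2^-1 -> mdist x' v <= 2^-1 ->
  mdist x' v ^+ 2 <= mdist x v ^+ 2 + 2 * tau * (F v - F x')
    + 2 * L * tau * mdist x' v ^+ 2 + C * mdist x x' ^+ 2.
Proof.
move=> oS t0 pr Dx Dv d1 d2.
have [x1 x2] := Dx; have [v1 v2] := Dv.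
have [//|//|g [gg g0 g1 [c1 c2] vg]] := reg x x' v x1 x2 v1 v2.
have cg : convex_along (phi1 \+ phi2)%E (lambda1 + lambda2) g.
  move=> s s01; have := c1 s s01; have := c2 s s01.
  rewrite g0 g1 (sum_fineE _ Dx) (sum_fineE _ Dv).
  rewrite -(dom_fineK phi1 x') // -(dom_fineK phi1 v) //.
  rewrite -(dom_fineK phi2 x') // -(dom_fineK phi2 v) // => k2 k1.
  apply: le_trans (leeD k1 k2) _.
  rewrite -!EFinM -!EFinB -!EFinD lee_fin /value /value1 /value2; lra.
have := @prox_EVI R X _ _ _ _ _ (F x') (F v) _ _ _ _ oS t0 pr gg g0 g1 _ _ cg vg.
rewrite !sum_fineE // => /(_ erefl erefl) e.
have : `|lambda1 + lambda2| * tau * mdist x' v ^+ 2 <= 2 * L * tau * mdist x' v ^+ 2.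
  rewrite ler_wpM2r ?sqr_ge0 // ler_wpM2r ?(ltW t0) //.
  by rewrite (le_trans (ler_normD _ _)) //; have := L1; have := L2; lra.
lra.
Qed.

(** Sum of [alternating_step] tested at [x] and [sum_prox_step] tested at [z']: [F z'] and the
    leading [mdist z' x ^+ 2] cancel. The constants are 17 = 3 * 3 + 2 * 4, from splitting the
    remaining squared distances into 3 and 4 squares, and 19 = 17 + 2. *)
Lemma comparison_step (S : set X) (tau delta : R) (z zh z' x x' : X) : open S ->
  0 < tau <= 1 ->
  prox [set: X] phi1 tau z zh -> prox [set: X] phi2 tau zh z' ->
  prox S (phi1 \+ phi2)%E tau x x' ->
  D zh -> D z' -> D x -> D x' ->
  F1 z' - F1 zh <= delta ->
  mdist z zh <= 16^-1 -> mdist zh z' <= 16^-1 -> mdist x x' <= 16^-1 ->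
  mdist z x <= 16^-1 ->
  mdist z' x' ^+ 2 <= (1 + 17 * L * tau) * mdist z x ^+ 2
   + 2 * tau * (F x - F x') + 2 * tau * delta
   + (C + 19 * L) * (mdist z zh ^+ 2 + mdist zh z' ^+ 2 + mdist x x' ^+ 2).
Proof.
move=> oS t01 p1 p2 pr Dzh Dz' Dx Dx' del d1 d2 d3 d4.
have tr1 := metric_triangle z' zh x; have tr2 := metric_triangle zh z x.
have tr3 := metric_triangle x' x z'.
rewrite [mdist z' zh]metric_sym in tr1; rewrite [mdist zh z]metric_sym in tr2.
rewrite [mdist x' x]metric_sym [mdist x z']metric_sym in tr3.
have dge (u v : X) : 0 <= mdist u v := mdist_ge0 _ _.
have f1 : mdist z zh <= 4^-1 by lra.
have f2 : mdist zh z' <= 4^-1 by lra.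
have f3 : mdist z' x <= 4^-1 by lra.
have e1 := alternating_step _ _ _ _ _ _ t01 p1 p2 Dzh Dz' Dx f1 f2 f3 del.
case/andP: t01 => t0 t1.
have f4 : mdist x x' <= 2^-1 by lra.
have f5 : mdist x' z' <= 2^-1 by lra.
have e2 := sum_prox_step _ _ _ _ _ oS t0 pr Dx' Dz' f4 f5.
rewrite [mdist x z']metric_sym in e2; rewrite [mdist x' z']metric_sym in e2 tr3.
move: (mdist z zh) (mdist zh z') (mdist z x) (mdist x x') (mdist z' x) (mdist z' x')
  (mdist zh x)
  (dge z zh) (dge zh z') (dge z x) (dge x x') (dge z' x) (dge z' x')
  d1 d2 d3 d4 tr1 tr2 tr3 e1 e2.
move=> a b c d p q r a0 b0 c0 d0 p0 q0 d1 d2 d3 d4 tr1 tr2 tr3 e1 e2.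
have P : p ^+ 2 <= 3 * (a ^+ 2 + b ^+ 2 + c ^+ 2).
  have : p ^+ 2 <= (a + b + c) ^+ 2 by rewrite ler_pXn2r ?nnegrE //; lra.
  have := sqr_ge0 (a - b); have := sqr_ge0 (b - c); have := sqr_ge0 (a - c); lra.
have Q : q ^+ 2 <= 4 * (a ^+ 2 + b ^+ 2 + c ^+ 2 + d ^+ 2).
  have : q ^+ 2 <= (a + b + c + d) ^+ 2 by rewrite ler_pXn2r ?nnegrE //; lra.
  have := sqr_ge0 (a - b); have := sqr_ge0 (b - c); have := sqr_ge0 (a - c).
  have := sqr_ge0 (a - d); have := sqr_ge0 (b - d); have := sqr_ge0 (c - d); lra.
have Lt : 0 <= L * tau by rewrite mulr_ge0 // ltW.
have P' := ler_wpM2l Lt P; have Q' := ler_wpM2l Lt Q.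
have LtL : L * tau * (a ^+ 2 + b ^+ 2 + d ^+ 2) <= L * (a ^+ 2 + b ^+ 2 + d ^+ 2).
  by rewrite ler_wpM2r ?addr_ge0 ?sqr_ge0 // ler_piMr.
have Ld : 0 <= L * d ^+ 2 by rewrite mulr_ge0 ?sqr_ge0.
have Ltd : 0 <= L * tau * d ^+ 2 by rewrite mulr_ge0 ?sqr_ge0.
lra.
Qed.

End Steps.

(** * Energy estimates *)

Section RealSequences.
Context {R : realType}.
Implicit Types (f a h tau : nat -> R).

Lemma sum_shift_le f m n : (forall k, (k < m + n)%N -> 0 <= f k) ->
  \sum_(i < n) f (m + i)%N <= \sum_(k < m + n) f k.
Proof.
move=> f0; rewrite big_split_ord/= lerDr sumr_ge0 // => i _.
by apply: f0; have := ltn_ord i; lia.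
Qed.

Lemma term_le_sum f n k : (forall i, (i < n)%N -> 0 <= f i) -> (k < n)%N ->
  f k <= \sum_(i < n) f i.
Proof.
move=> f0 kn; rewrite (bigD1 (Ordinal kn))//= lerDl sumr_ge0 // => i _.
exact: f0.
Qed.

Lemma sum_mono f m n : (forall i, (i < n)%N -> 0 <= f i) -> (m <= n)%N ->
  \sum_(i < m) f i <= \sum_(i < n) f i.
Proof.
move=> f0 mn; rewrite -(subnKC mn) big_split_ord/= lerDl sumr_ge0 // => i _.
by apply: f0; rewrite -ltn_subRL.
Qed.

Lemma telescope_ord f m n :
  \sum_(i < n) (f (m + i.+1)%N - f (m + i)%N) = f (m + n)%N - f m.
Proof.
elim: n => [|n IH]; first by rewrite big_ord0 addn0 subrr.
by rewrite big_ord_recr/= IH addrC addrA subrK.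
Qed.

(* The one-step inequality is only available while [a] stays below [G]. *)
Lemma gronwall_bootstrap a h tau (M delta G : R) n :
  0 <= M -> 0 <= delta -> 0 <= a 0%N ->
  (forall i, (i < n)%N -> 0 <= h i) -> (forall i, (i < n)%N -> 0 <= tau i) ->
  (forall i, (i < n)%N -> a i <= G -> a i.+1 <= (1 + M * tau i) * a i + delta * h i) ->
  expR (M * \sum_(i < n) tau i) * (a 0%N + delta * \sum_(i < n) h i) <= G ->
  a n <= expR (M * \sum_(i < n) tau i) * (a 0%N + delta * \sum_(i < n) h i).
Proof.
move=> M0 d0 a0 h0 t0 step bnd.
suff H k : (k <= n)%N ->
    a k <= expR (M * \sum_(i < k) tau i) * (a 0%N + delta * \sum_(i < k) h i).
  exact: H.
(* The bound grows with the index, so its final value, being at most [G], keeps every earlier [a k]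
   within the range of the one-step inequality. *)
have mono (k' l : nat) : (k' <= l)%N -> (l <= n)%N ->
    expR (M * \sum_(i < k') tau i) * (a 0%N + delta * \sum_(i < k') h i) <=
    expR (M * \sum_(i < l) tau i) * (a 0%N + delta * \sum_(i < l) h i).
  move=> kl ln; apply: ler_pM.
  - exact: expR_ge0.
  - rewrite addr_ge0 ?mulr_ge0 ?sumr_ge0 // => i _; apply: h0.
    by have := ltn_ord i; lia.
  - rewrite ler_expR ler_wpM2l ?sum_mono // => i il; apply: t0; lia.
  - by rewrite lerD2l ler_wpM2l ?sum_mono // => i il; apply: h0; lia.
elim: k => [_|k IH kn].
  by rewrite !big_ord0 !mulr0 expR0 mul1r addr0.
have ak := IH (ltnW kn).
have aG : a k <= G by apply: le_trans ak (le_trans (mono _ _ (ltnW kn) (leqnn _)) bnd).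
apply: le_trans (step k kn aG) _.
rewrite !big_ord_recr/= !mulrDr expRD.
set S := M * \sum_(i < k) tau i in ak *; set H := \sum_(i < k) h i in ak *.
have S0 : 0 <= S.
  rewrite mulr_ge0 // sumr_ge0 // => i _; exact: t0 (ltn_trans (ltn_ord i) kn).
have e1 : 1 <= expR S by rewrite -expR0 ler_expR.
have e2 : 1 + M * tau k <= expR (M * tau k) := expR_ge1Dx _.
have mt : 0 <= M * tau k by rewrite mulr_ge0 ?t0.
have E1 : (1 + M * tau k) * a k <= expR (M * tau k) * (expR S * (a 0%N + delta * H)).
  apply: (@le_trans _ _ ((1 + M * tau k) * (expR S * (a 0%N + delta * H)))).
    by apply: ler_wpM2l => //; lra.
  apply: ler_wpM2r => //; rewrite mulr_ge0 ?expR_ge0 // addr_ge0 //.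
  rewrite mulr_ge0 // sumr_ge0 // => i _.
  exact: h0 (ltn_trans (ltn_ord i) kn).
have E2 : delta * h k <= expR (M * tau k) * expR S * (delta * h k).
  rewrite ler_peMl ?mulr_ge0 ?h0 //.
  by rewrite -[leLHS]mulr1; apply: ler_pM => //; lra.
rewrite -!mulrDr; lra.
Qed.

End RealSequences.

(** * Energy and Hoelder estimates along the alternating scheme *)

Section Energy.
Context {R : realType} {X : metricType R} (phi1 phi2 : X -> \bar R).
Hypothesis phi1_gtNy : forall x, (-oo < phi1 x)%E.
Hypothesis phi2_gtNy : forall x, (-oo < phi2 x)%E.
Local Notation D := (finite_dom phi1 phi2).
Local Notation F1 := (value1 phi1).
Local Notation F2 := (value2 phi2).
Local Notation F := (value phi1 phi2).
Context (mu : R).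
Hypothesis mu_le : forall x, D x -> mu <= F x.

Definition split_step_sqr (zh z : nat -> X) k : R :=
  mdist (z k) (zh k.+1) ^+ 2 + mdist (zh k.+1) (z k.+1) ^+ 2.

(** Outcome of the energy estimate up to step [N]: [del] is a real majorant of the increase of
    [phi1] in the second half steps, and one constant [E] bounds both its sum and the discrete
    action. *)
Definition controlled (E : R) (t : nat -> R) (zh z : nat -> X) (del : nat -> R)
    (N : nat) : Prop :=
  [/\ forall k, (k <= N)%N -> D (z k),
      forall k, (k < N)%N -> D (zh k.+1) /\ 0 <= del k /\ F1 (z k.+1) - F1 (zh k.+1) <= del k,
      \sum_(k < N) del k <= E &
      \sum_(k < N) split_step_sqr zh z k / (t k.+1 - t k) <= E].

Lemma mesh_lt (t : nat -> R) (e : R) k : (mesh t < e%:E)%E -> t k.+1 - t k < e.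
Proof.
move=> h; rewrite -lte_fin; apply: le_lt_trans h.
by apply: ereal_sup_ubound; exists k.
Qed.

Lemma partition_mono (t : nat -> R) k l :
  partition_of_half_line t -> (k <= l)%N -> t k <= t l.
Proof.
move=> [_ tlt _]; elim: l => [|l IH]; first by rewrite leqn0 => /eqP ->.
rewrite leq_eqVlt => /orP[/eqP -> //|kl]; apply: le_trans (IH _) (ltW (tlt l)); lia.
Qed.

(** Each half step lowers its own functional by at least the squared displacement over [2 tau] and
    raises the other by at most the defect. In the sum the values of [F] telescope against the lower
    bound [mu], and [4 * |Delta|] pays for the defects. *)
Lemma alternating_controlled (z0 : X) (T : R) : D z0 -> summable_defects phi1 phi2 z0 ->
  0 < T -> exists2 E : R, 0 <= E &
  forall t zh z N, partition_of_half_line t -> (mesh t < 1%:E)%E -> t N <= T ->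
    alternating_solution phi1 phi2 z0 t zh z -> exists del, controlled E t zh z del N.
Proof.
move=> Dz0 sd T0; have [Delta HD] := sd 1 T ltr01 T0.
exists (2 * (F z0 - mu) + 4 * `|Delta|).
  have := mu_le _ Dz0; have := normr_ge0 Delta; lra.
move=> t zh z N pt mt tN alt; have := HD t zh z N pt mt tN alt; case: alt => z00 alt.
set sdf := splitting_defect phi1 phi2 zh z => HS.
have s0 k : (0%E <= sdf k)%E by rewrite /sdf /splitting_defect le_max lexx.
have sN k : (k < N)%N -> (sdf k <= Delta%:E)%E.
  move=> kN; apply: le_trans HS.
  apply: (@le_trans _ _ (\sum_(0 <= i < k.+1) sdf i)%E); last exact: lee_sum_nneg_natr.
  by rewrite big_nat_recr//= leeDr // sume_ge0.
have tau0 k : 0 < t k.+1 - t k by case: pt => _ + _; rewrite subr_gt0; apply.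
(* A finite defect excludes the value [+oo] at the new point; this carries membership in the common
   domain from one half step to the next. *)
have fin1 k x y (f : X -> \bar R) : (f x - f y <= sdf k)%E -> (k < N)%N ->
    (forall x, (-oo < f x)%E) -> dom f y ->
    dom f x /\ fine (f x) - fine (f y) <= fine (sdf k).
  move=> h kN fNy dy; have h2 := sN k kN; move: h h2 (s0 k).
  rewrite -(dom_fineK _ _ (fNy y) dy); move: (fNy x); rewrite /dom/=.
  by case: (f x) => [a||] //; case: (sdf k) => [b||] // _; rewrite -?EFinB ?lee_fin.
have Dstep k : (k < N)%N -> D (z k) -> [/\ D (zh k.+1), D (z k.+1),
    F1 (z k.+1) - F1 (zh k.+1) <= fine (sdf k) &
    split_step_sqr zh z k / (t k.+1 - t k) <=
      2 * (F (z k) - F (z k.+1)) + 4 * fine (sdf k)].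
  move=> kN [d1 d2]; have [p1 p2] := alt k.
  have [h1 e1] := prox_energy _ _ _ _ _ (phi1_gtNy _) (phi1_gtNy _) (tau0 k) p1 I d1.
  have sd1 : (phi2 (zh k.+1) - phi2 (z k) <= sdf k)%E.
    by rewrite /sdf /splitting_defect !le_max lexx orbT.
  have [h2 e2] := fin1 k _ _ phi2 sd1 kN phi2_gtNy d2.
  have [g2 e3] := prox_energy _ _ _ _ _ (phi2_gtNy _) (phi2_gtNy _) (tau0 k) p2 I h2.
  have sd2 : (phi1 (z k.+1) - phi1 (zh k.+1) <= sdf k)%E.
    by rewrite /sdf /splitting_defect !le_max lexx !orbT.
  have [g1 e4] := fin1 k _ _ phi1 sd2 kN phi1_gtNy h1.
  split => //; rewrite ler_pdivrMr // /split_step_sqr.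
  have k1 := ler_wpM2l (ltW (tau0 k)) e2; have k2 := ler_wpM2l (ltW (tau0 k)) e4.
  rewrite /value /value1 /value2; lra.
have Dz k : (k <= N)%N -> D (z k).
  elim: k => [_|k IH kN]; first by rewrite z00.
  by have [] := Dstep k kN (IH (ltnW kN)).
have HS' : \sum_(k < N) fine (sdf k) <= Delta.
  rewrite -lee_fin; apply: le_trans HS.
  rewrite big_mkord -sumEFin; apply: lee_sum => i _.
  rewrite fineK // ge0_fin_numE //; exact: le_lt_trans (sN _ (ltn_ord i)) (ltry _).
have Dle := ler_norm Delta.
exists (fun k => fine (sdf k)); split => //.
- move=> k kN; have [? _ ? _] := Dstep k kN (Dz _ (ltnW kN)).
  by split => //; split => //; exact: fine_ge0.
- have := mu_le _ Dz0; have := normr_ge0 Delta; lra.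
- apply: (@le_trans _ _ (\sum_(k < N) (2 * (F (z k) - F (z k.+1)) + 4 * fine (sdf k)))).
    by apply: ler_sum => i _; have [] := Dstep i (ltn_ord i) (Dz _ (ltnW (ltn_ord i))).
  rewrite big_split/= -!mulr_sumr.
  have -> : \sum_(k < N) (F (z k) - F (z k.+1)) = F (z 0%N) - F (z N).
    have := telescope_ord (F \o z) 0 N; rewrite !add0n/= => h.
    rewrite -[RHS]opprB -h -sumrN; apply: eq_bigr => i _.
    by rewrite opprB !add0n.
  have := mu_le _ (Dz N (leqnn N)); rewrite z00; lra.
Qed.

Lemma controlled_step E t zh z del N k : partition_of_half_line t ->
  controlled E t zh z del N -> (k < N)%N ->
  split_step_sqr zh z k <= E * (t k.+1 - t k).
Proof.
move=> [_ tlt _] [_ _ _ HE] kN; have tau0 : 0 < t k.+1 - t k by rewrite subr_gt0.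
rewrite -ler_pdivrMr //; apply: le_trans HE.
apply: (term_le_sum (fun k => split_step_sqr zh z k / (t k.+1 - t k))) kN => i _.
by rewrite divr_ge0 //; [rewrite addr_ge0 ?sqr_ge0|rewrite subr_ge0 ltW].
Qed.

(** Each half step of length [a] satisfies [a <= (theta a^2 / tau + tau / theta) / 2], and these
    bounds are summed. The best [theta] would give the 1/2-Hoelder bound [2 sqrt (E (t l - t k))]; a
    free [theta] avoids square roots. *)
Lemma controlled_holder E t zh z del N k l theta : partition_of_half_line t ->
  controlled E t zh z del N -> (k <= l)%N -> (l <= N)%N -> 0 < theta ->
  mdist (z k) (z l) <= theta * E + (t l - t k) / theta.
Proof.
move=> pt [_ _ _ HE] kl lN th0; have [_ tlt _] := pt.
have tau0 i : 0 < t i.+1 - t i by rewrite subr_gt0.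
pose q i := split_step_sqr zh z i / (t i.+1 - t i).
have q0 i : 0 <= q i by rewrite divr_ge0 //; [rewrite addr_ge0 ?sqr_ge0|rewrite ltW].
have step i : mdist (z i) (z i.+1) <= theta * q i + (t i.+1 - t i) / theta.
  have am (a : R) : 0 <= a ->
      a <= (theta * (a ^+ 2 / (t i.+1 - t i)) + (t i.+1 - t i) / theta) / 2.
    move=> a0; have := sqr_ge0 (theta * a - (t i.+1 - t i)).
    have tt : 0 < theta * (t i.+1 - t i) by rewrite mulr_gt0.
    rewrite -subr_ge0 => h; rewrite -subr_ge0.
    have -> : (theta * (a ^+ 2 / (t i.+1 - t i)) + (t i.+1 - t i) / theta) / 2 - a =
       (theta * a - (t i.+1 - t i)) ^+ 2 / (2 * (theta * (t i.+1 - t i))).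
      by field; rewrite !gt_eqF.
    by rewrite divr_ge0 ?sqr_ge0 // mulr_ge0 // ltW.
  apply: le_trans (metric_triangle _ (zh i.+1) _) _.
  have := am _ (mdist_ge0 (z i) (zh i.+1)); have := am _ (mdist_ge0 (zh i.+1) (z i.+1)).
  have : 0 <= theta * q i by rewrite mulr_ge0 // ltW.
  rewrite /q /split_step_sqr mulrDl mulrDr; lra.
have main : mdist (z k) (z l) <=
    theta * (\sum_(i < l) q i - \sum_(i < k) q i) + (t l - t k) / theta.
  move: kl {lN}; elim: l => [|l IH].
    by rewrite leqn0 => /eqP ->; rewrite mdistxx !subrr mulr0 mul0r addr0.
  rewrite leq_eqVlt => /orP[/eqP ->|kl].
    by rewrite mdistxx !subrr mulr0 mul0r addr0.
  apply: le_trans (metric_triangle _ (z l) _) _; apply: le_trans (lerD (IH kl) (step l)) _.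
  rewrite big_ord_recr/= !mulrBl !mulrBr !mulrDr; lra.
apply: le_trans main _; rewrite lerD2r; apply: ler_wpM2l; first exact: ltW.
have : \sum_(i < l) q i <= E by apply: le_trans (sum_mono q _ _ _ lN) HE.
have : 0 <= \sum_(i < k) q i by rewrite sumr_ge0.
lra.
Qed.

End Energy.

(** * Comparison of the two schemes *)

Section Comparison.
Context {R : realType} {X : metricType R} (phi1 phi2 : X -> \bar R).
Context (lambda1 lambda2 C L mu : R).
Hypothesis phi1_gtNy : forall x, (-oo < phi1 x)%E.
Hypothesis phi2_gtNy : forall x, (-oo < phi2 x)%E.
Local Notation D := (finite_dom phi1 phi2).
Local Notation F1 := (value1 phi1).
Local Notation F := (value phi1 phi2).
Local Notation phi := (phi1 \+ phi2)%E.
Hypothesis reg : regular_geodesics phi1 phi2 lambda1 lambda2 C.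
Hypothesis C0 : 0 <= C.
Hypothesis L1 : `|lambda1| <= L.
Hypothesis L2 : `|lambda2| <= L.
Hypothesis mu_le : forall x, D x -> mu <= F x.

Lemma sum_prox_energy (S : set X) (tau : R) x x' : 0 < tau -> prox S phi tau x x' ->
  S x -> D x -> D x' /\ mdist x x' ^+ 2 <= 2 * tau * (F x - F x').
Proof.
move=> t0 pr Sx Dx.
have gtNy y : (-oo < phi y)%E by exact: sum_gtNy.
have domE := dom_sum _ _ phi1_gtNy phi2_gtNy.
have [d e] := prox_energy _ _ _ _ _ (gtNy _) (gtNy _) t0 pr Sx ((domE _).2 Dx).
have Dx' := (domE _).1 d.
by split => //; move: e; rewrite !sum_fineE.
Qed.

(** The squared displacements are at most [E tau] and [2 B tau], so 512 = 2 * 16^2 gives the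
    smallness asked for by [comparison_step]. The error becomes [tau] times a quantity whose sum
    over the steps stays bounded. *)
Lemma comparison_step_budget (S : set X) (tau delta E B : R) (z zh z' x x' : X) :
  open S -> 0 < tau <= 1 ->
  prox [set: X] phi1 tau z zh -> prox [set: X] phi2 tau zh z' -> prox S phi tau x x' ->
  D zh -> D z' -> S x -> D x -> F1 z' - F1 zh <= delta ->
  0 <= E -> 0 <= B ->
  mdist z zh ^+ 2 + mdist zh z' ^+ 2 <= E * tau -> F x - F x' <= B ->
  (E + B) * tau <= 512^-1 -> mdist z x <= 16^-1 ->
  mdist z' x' ^+ 2 <= (1 + 17 * L * tau) * mdist z x ^+ 2 +
    tau * (2 * (F x - F x') + 2 * delta + (C + 19 * L) *
      ((mdist z zh ^+ 2 + mdist zh z' ^+ 2) / tau + 2 * (F x - F x'))).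
Proof.
move=> oS t01 p1 p2 pr Dzh Dz' Sx Dx del E0 B0 eE FB EB d4.
have /andP[t0 t1] := t01.
have [Dx' ex] := sum_prox_energy _ _ _ _ t0 pr Sx Dx.
have small (y : R) : 0 <= y -> y ^+ 2 <= 256^-1 -> y <= 16^-1.
  move=> y0 y2; rewrite -(@ler_pXn2r _ 2) ?nnegrE //.
  by apply: le_trans y2 _; rewrite exprVn lef_pV2 ?posrE -?natrX ?ltr0n ?ler_nat.
have Bt : tau * (F x - F x') <= tau * B by rewrite ler_wpM2l // ltW.
have Et : 0 <= tau * E by rewrite mulr_ge0 // ltW.
have Bt0 : 0 <= tau * B by rewrite mulr_ge0 // ltW.
have s1 := sqr_ge0 (mdist z zh); have s2 := sqr_ge0 (mdist zh z').
have d1 : mdist z zh <= 16^-1 by apply: small; rewrite ?mdist_ge0 //; lra.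
have d2 : mdist zh z' <= 16^-1 by apply: small; rewrite ?mdist_ge0 //; lra.
have d3 : mdist x x' <= 16^-1 by apply: small; rewrite ?mdist_ge0 //; lra.
have := comparison_step _ _ _ _ _ _ phi1_gtNy phi2_gtNy reg L1 L2 S tau delta
  _ _ _ _ _ oS t01 p1 p2 pr Dzh Dz' Dx Dx' del d1 d2 d3 d4.
have N00 : 0 <= C + 19 * L.
  by have := C0; have := le_trans (normr_ge0 _) L1; lra.
have := ler_wpM2l N00 ex.
have -> : tau * (2 * (F x - F x') + 2 * delta + (C + 19 * L) *
      ((mdist z zh ^+ 2 + mdist zh z' ^+ 2) / tau + 2 * (F x - F x'))) =
  2 * tau * (F x - F x') + 2 * tau * delta + (C + 19 * L) *
     (mdist z zh ^+ 2 + mdist zh z' ^+ 2) + (C + 19 * L) * (2 * tau * (F x - F x')).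
  by field; rewrite gt_eqF.
lra.
Qed.

(** Discrete Groenwall argument for the squared distance of the two schemes: step [i] adds at most
    [del * h i], where the sum of the [h i] is bounded by [Hh] for every partition. Starting the
    discrete solution at an arbitrary grid time [t m] allows restarts. *)
Lemma alternating_close (z0 : X) (T : R) : D z0 -> summable_defects phi1 phi2 z0 ->
  0 < T -> forall (x0 : X) (eta : R), D x0 -> 0 < eta ->
  exists rho del : R, [/\ 0 < rho, 0 < del &
    forall t zh z m (S : set X) (H : \bar R) x, open S -> S x0 ->
      partition_of_half_line t -> (mesh t < del%:E)%E ->
      alternating_solution phi1 phi2 z0 t zh z ->
      discrete_solution S phi x0 H (fun i => t (m + i)%N - t m) x ->
      mdist (z m) x0 < rho ->
      forall n, t (m + n)%N <= T ->
        (forall i, (i < n)%N -> ((t (m + i)%N - t m)%:E < H)%E) ->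
        mdist (z (m + n)%N) (x n) < eta].
Proof.
move=> Dz0 sd T0 x0 eta Dx0 eta0.
have [E E0 HE] := alternating_controlled _ _ phi1_gtNy phi2_gtNy _ mu_le _ _ Dz0 sd T0.
have L0 : 0 <= L by apply: le_trans (normr_ge0 _) L1.
set B := F x0 - mu; have B0 : 0 <= B by rewrite subr_ge0 mu_le.
set N0 := C + 19 * L; have N00 : 0 <= N0 by rewrite /N0; have := C0; lra.
(* Majorant of the sum of the errors [h i] below: [F] drops by at most [B] along [x], and the
   defects and the action of the alternating scheme are at most [E] each. *)
set Hh := (2 + 2 * N0) * B + (2 + N0) * E.
have Hh0 : 0 <= Hh by rewrite addr_ge0 ?mulr_ge0 //; lra.
set M := 17 * L; have M0 : 0 <= M by rewrite /M; lra.
pose r := Num.min (16^-1) eta.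
have r0 : 0 < r by rewrite lt_min eta0 andbT; lra.
have [r1 r2] : r <= 16^-1 /\ r <= eta by rewrite !ge_min !lexx orbT.
(* Chosen so that [expR (M * T) * (kappa + kappa) = r ^+ 2 / 2]: one [kappa] for the initial squared
   distance, one for the accumulated error. *)
pose kappa := r ^+ 2 / 4 / expR (M * T).
have k0 : 0 < kappa by rewrite !divr_gt0 ?expR_gt0 ?exprn_gt0.
have kE : expR (M * T) * kappa = r ^+ 2 / 4 by rewrite /kappa mulrC divfK ?gt_eqF ?expR_gt0.
pose rho := Num.min 1 kappa.
have rho0 : 0 < rho by rewrite lt_min ltr01.
have [rho1 rhok] : rho <= 1 /\ rho <= kappa by rewrite !ge_min !lexx orbT.
(* [d1] makes each step short enough for [comparison_step_budget]; [d2] makes [del * Hh] at most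
   [kappa]. *)
pose d1 := (512 * (E + B + 1))^-1; pose d2 := kappa / (Hh + 1).
have EB : 0 < 512 * (E + B + 1) by lra.
have d10 : 0 < d1 by rewrite invr_gt0.
have d20 : 0 < d2 by rewrite divr_gt0 //; lra.
pose del := Num.min 1 (Num.min d1 d2).
have del0 : 0 < del by rewrite !lt_min ltr01 d10.
have [delle1 delled1 delled2] : [/\ del <= 1, del <= d1 & del <= d2] by rewrite !ge_min !lexx !orbT.
have delEB : del * (E + B + 1) <= 512^-1.
  have : d1 * (512 * (E + B + 1)) = 1 by exact: mulVf (lt0r_neq0 EB).
  have : del * (E + B + 1) <= d1 * (E + B + 1) by rewrite ler_wpM2r //; lra.
  lra.
have delH : del * Hh <= kappa.
  have : d2 * (Hh + 1) = kappa by rewrite divfK // gt_eqF //; lra.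
  have : del * (Hh + 1) <= d2 * (Hh + 1) by rewrite ler_wpM2r //; lra.
  nra.
exists rho, del; split => // t zh z m S H x oS Sx0 pt mt alt [x00 xs] dm n tn nH.
have mt1 : (mesh t < 1%:E)%E by apply: lt_le_trans mt _; rewrite lee_fin.
have [dl ctl] := HE t zh z (m + n)%N pt mt1 tn alt.
have [Dz Dzh Hdl Hq] := ctl.
have [_ tlt _] := pt.
pose tau i := t (m + i.+1)%N - t (m + i)%N.
have tau0 i : 0 < tau i by rewrite /tau addnS subr_gt0.
have taud i : tau i < del by rewrite /tau addnS; apply: mesh_lt.
have pr i : (i < n)%N -> prox S phi (tau i) (x i) (x i.+1).
  by move=> /nH/xs; rewrite opprB addrA subrK.
have SDx i : (i <= n)%N -> S (x i) /\ D (x i).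
  elim: i => [_|i IH lin]; first by rewrite x00.
  have [Si Di] := IH (ltnW lin); split; first by have [] := pr i lin.
  by have [] := sum_prox_energy S _ _ _ (tau0 i) (pr i lin) Si Di.
have en i : (i < n)%N -> mdist (x i) (x i.+1) ^+ 2 <= 2 * tau i * (F (x i) - F (x i.+1)).
  move=> lin; have [Si Di] := SDx i (ltnW lin).
  by have [] := sum_prox_energy S _ _ _ (tau0 i) (pr i lin) Si Di.
have dec i : (i < n)%N -> 0 <= F (x i) - F (x i.+1).
  move=> lin; have := le_trans (sqr_ge0 _) (en i lin).
  by rewrite pmulr_rge0 // mulr_gt0.
have tele k : \sum_(i < k) (F (x i) - F (x i.+1)) = F x0 - F (x k).
  have := telescope_ord (F \o x) 0 k; rewrite !add0n/= => h.
  rewrite -[RHS]opprB -x00 -h -sumrN; apply: eq_bigr => i _.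
  by rewrite opprB !add0n.
pose q k := split_step_sqr zh z k / (t k.+1 - t k).
have q0 k : 0 <= q k.
  rewrite divr_ge0 //; first by rewrite addr_ge0 ?sqr_ge0.
  by rewrite subr_ge0 ltW.
pose a i := mdist (z (m + i)%N) (x i) ^+ 2.
pose h i := 2 * (F (x i) - F (x i.+1)) + 2 * dl (m + i)%N
   + N0 * (q (m + i)%N + 2 * (F (x i) - F (x i.+1))).
have dl0 k : (k < m + n)%N -> 0 <= dl k by move=> /Dzh[_ []].
have h0 i : (i < n)%N -> 0 <= h i.
  move=> lin; have := dec i lin; have := dl0 (m + i)%N; rewrite ltn_add2l lin => /(_ isT).
  have := q0 (m + i)%N => ? ? ?.
  have : 0 <= N0 * (q (m + i)%N + 2 * (F (x i) - F (x i.+1))).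
    by apply: mulr_ge0 => //; lra.
  rewrite /h; lra.
have sumh : \sum_(i < n) h i <= Hh.
  have -> : \sum_(i < n) h i = 2 * \sum_(i < n) (F (x i) - F (x i.+1))
      + 2 * \sum_(i < n) dl (m + i)%N
      + N0 * (\sum_(i < n) q (m + i)%N + 2 * \sum_(i < n) (F (x i) - F (x i.+1))).
    by rewrite !mulr_sumr -!big_split/= mulr_sumr -big_split.
  rewrite tele.
  have s1 : \sum_(i < n) dl (m + i)%N <= E := le_trans (sum_shift_le dl m n dl0) Hdl.
  have s2 : \sum_(i < n) q (m + i)%N <= E by apply: le_trans (sum_shift_le q m n _) Hq.
  have s3 : F x0 - F (x n) <= B.
    by rewrite /B lerD2l lerN2 mu_le //; have [] := SDx n (leqnn n).
  have := ler_wpM2l N00 s2; have := ler_wpM2l N00 s3; rewrite /Hh; lra.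
have sumtau : \sum_(i < n) tau i <= T.
  rewrite telescope_ord.
  have := partition_mono t 0 m pt (leq0n _); case: pt => -> _ _; lra.
have bnd : expR (M * \sum_(i < n) tau i) * (a 0%N + del * \sum_(i < n) h i) <= r ^+ 2 / 2.
  apply: (@le_trans _ _ (expR (M * T) * (kappa + kappa))); last by rewrite mulrDr kE; lra.
  apply: ler_pM.
  - exact: expR_ge0.
  - apply: addr_ge0; first exact: sqr_ge0.
    by apply: mulr_ge0; [exact: ltW|apply: sumr_ge0 => i _; exact: h0].
  - by rewrite ler_expR ler_wpM2l.
  - apply: lerD; last by apply: le_trans delH; rewrite ler_wpM2l // ltW.
    rewrite /a addn0 x00; apply: le_trans rhok.
    rewrite expr2 -[rho]mulr1; apply: ler_pM; rewrite ?mdist_ge0 //; first exact: ltW.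
    exact: le_trans (ltW dm) rho1.
have r20 : 0 < r ^+ 2 by rewrite exprn_gt0.
have G0 : r ^+ 2 / 2 < r ^+ 2 by rewrite ltr_pdivrMr // ltr_pMr // ltr1n.
have an := gronwall_bootstrap a h tau M del (r ^+ 2 / 2) n M0 (ltW del0)
  (sqr_ge0 _) h0 (fun i _ => ltW (tau0 i)) _ bnd.
suff an' : a n <= r ^+ 2 / 2.
  have := le_lt_trans an' G0; rewrite /a ltr_pXn2r ?nnegrE ?mdist_ge0 ?(ltW r0) // => h'.
  exact: lt_le_trans h' r2.
(* What remains is the one-step inequality under [a i <= r ^+ 2 / 2], which yields the distance
   bound 1/16 asked for by the step estimate. *)
apply: le_trans (an _) bnd => i lin ai.
have lmi : (m + i < m + n)%N by rewrite ltn_add2l.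
have [Dz1 [_ del1]] := Dzh _ lmi.
have [p1 p2] := alt.2 (m + i)%N.
have tau1 : 0 < tau i <= 1 by rewrite tau0 (le_trans (ltW (taud i))).
have ss := controlled_step _ _ E t zh z dl _ _ pt ctl lmi.
have tauE : tau i = t (m + i).+1 - t (m + i)%N by rewrite /tau addnS.
rewrite -tauE in p1 p2 ss.
have EBt : (E + B) * tau i <= 512^-1.
  apply: le_trans delEB; rewrite mulrC; apply: ler_pM => //; first exact: ltW.
  - exact: addr_ge0.
  - exact: ltW.
  - by rewrite lerDl.
have F1i : F (x i) - F (x i.+1) <= B.
  have Fi : F (x i) <= F x0.
    rewrite -subr_ge0 -tele sumr_ge0 // => j _; apply: dec.
    exact: ltn_trans (ltn_ord j) lin.
  by rewrite /B lerB ?mu_le //; have [] := SDx _ lin.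
have c4 : mdist (z (m + i)%N) (x i) <= 16^-1.
  rewrite -(@ler_pXn2r _ 2) ?nnegrE ?mdist_ge0 //; apply: le_trans ai _.
  apply: le_trans (ltW G0) _; rewrite ler_pXn2r ?nnegrE //; exact: ltW.
have := comparison_step_budget S (tau i) (dl (m + i)%N) E B _ _ _ _ _ oS tau1 p1 p2
  (pr i lin) Dz1 (Dz _ lmi) (SDx i (ltnW lin)).1 (SDx i (ltnW lin)).2
  del1 E0 B0 ss F1i EBt c4.
rewrite {1}/a addnS -/M -/N0 => cs; apply: le_trans cs _; rewrite lerD2l.
have -> : split_step_sqr zh z (m + i) / tau i = q (m + i)%N by rewrite /q tauE.
by apply: ler_wpM2r; [exact: h0|exact: ltW].
Qed.

End Comparison.

(** * Existence of discrete solutions *)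

Section Minimizers.
Context {R : realType} {X : metricType R}.

(** The nonempty sublevels generate a filter, which clusters at some [z] by compactness. If
    [f w < f z], semicontinuity gives a neighbourhood of [z] disjoint from the sublevel at [f w], a
    contradiction. *)
Lemma lsc_minimizer (f : X -> \bar R) (x0 : X) (Q : R) : lower_semicontinuous f ->
  (forall x, (-oo < f x)%E) -> (f x0 <= Q%:E)%E ->
  precompact [set x | (f x <= Q%:E)%E] -> exists z, forall w, (f z <= f w)%E.
Proof.
move=> lsc fNy f0; rewrite precompactE => cpt.
pose B (c : R) := [set x | (f x <= c%:E)%E].
pose G := filter_from [set c : R | exists x, (f x <= c%:E)%E] B.
have FG : ProperFilter G.
  apply: filter_from_proper; last by move=> c [x fx]; exists x.
  apply: filter_from_filter; first by exists Q, x0.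
  move=> c c' [x fx] [x' fx']; exists (Num.min c c').
    have [_|_] := leP c c'; first by exists x.
    by exists x'.
  move=> y /= fy; split; apply: le_trans fy _; rewrite lee_fin ge_min lexx ?orbT //.
have GK : G (closure (B Q)).
  by exists Q; [exists x0|exact: subset_closure].
have [z [_ clz]] := cpt G FG GK.
exists z => w; rewrite leNgt; apply/negP => wz.
have fw : (fine (f w))%:E = f w.
  by move: (fNy w) wz; case: (f w) => // _; rewrite ltNge leey.
have [V Vz HV] : exists2 V, nbhs z V & forall y, V y -> ((fine (f w))%:E < f y)%E.
  by apply: lsc; rewrite fw.
have [|y [/= By /HV]] := clz (B (fine (f w))) V _ Vz.
  by exists (fine (f w)) => //; exists w; rewrite fw.
by rewrite ltNge By.
Qed.

Lemma lsc_add (f g : X -> \bar R) :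
  (forall x, (-oo < f x)%E) -> (forall x, (-oo < g x)%E) ->
  lower_semicontinuous f -> lower_semicontinuous g -> lower_semicontinuous (f \+ g)%E.
Proof.
move=> fNy gNy lf lg x a /= afg.
have [b [c [bf cg abc]]] : exists b c, [/\ (b%:E < f x)%E, (c%:E < g x)%E & a <= b + c].
  move: (fNy x) (gNy x) afg; case: (f x) => [u||] //; case: (g x) => [v||] // _ _.
  - rewrite -EFinD lte_fin => auv.
    by exists (u - (u + v - a) / 2), (v - (u + v - a) / 2); rewrite !lte_fin; split; lra.
  - by move=> _; exists (u - 1), (a - u + 1); rewrite lte_fin ltry; split => //; lra.
  - by move=> _; exists (a - v + 1), (v - 1); rewrite lte_fin ltry; split => //; lra.
  - by move=> _; exists a, 0; rewrite !ltry; split => //; lra.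
have [V Vx HV] := lf x b bf; have [W Wx HW] := lg x c cg.
exists (V `&` W); first exact: filterI.
move=> y [/HV h1 /HW h2]; apply: (@le_lt_trans _ _ (b + c)%:E); first by rewrite lee_fin.
by rewrite EFinD; apply: lteD.
Qed.

Lemma lsc_sqdist (x0 : X) (tau : R) : 0 < tau ->
  lower_semicontinuous (fun x => (mdist x0 x ^+ 2 / (2 * tau))%:E).
Proof.
move=> t0 x a; rewrite lte_fin => ax.
have t2 : 0 < 2 * tau by rewrite mulr_gt0.
set d := mdist x0 x in ax; have d0 : 0 <= d := mdist_ge0 _ _.
rewrite ltr_pdivlMr // in ax.
(* Moving by less than [r] lowers the squared distance by at most [2 d r], which is less than its
   excess over [2 tau a]. *)
pose r := (d ^+ 2 - a * (2 * tau)) / (2 * d + 1).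
have d1 : 0 < 2 * d + 1 by lra.
have r0 : 0 < r by rewrite divr_gt0 // subr_gt0.
have rE : r * (2 * d + 1) = d ^+ 2 - a * (2 * tau) by rewrite divfK // gt_eqF.
exists (ball x r); first exact: nbhsx_ballx.
move=> y; rewrite ballEmdist/= => xy; rewrite lte_fin ltr_pdivlMr //.
have tri := metric_triangle x0 y x; rewrite -/d [mdist y x]metric_sym in tri.
have := mdist_ge0 x0 y; have := mdist_ge0 x y.
move: (mdist x0 y) (mdist x y) tri xy => u v tri xy v0 u0.
have : 2 * d * v <= 2 * d * r by apply: ler_wpM2l; lra.
have [dv|dv] := leP d v; first by nra.
have : (d - v) ^+ 2 <= u ^+ 2 by rewrite ler_pXn2r ?nnegrE //; lra.
have := sqr_ge0 v; lra.
Qed.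

Lemma diam_bound : (diam X < +oo)%E -> exists M : R, forall x y : X, mdist x y <= M.
Proof.
move=> dX; have [[x0 _]|nX] := pselect (exists x : X, True); last first.
  by exists 0 => x; exfalso; apply: nX; exists x.
have ub (x y : X) : ((mdist x y)%:E <= diam X)%E.
  by apply: ereal_sup_ubound; exists (x, y).
move: dX ub; case: (diam X) => [M _ ub||_ /(_ x0 x0)] //.
by exists M => x y; rewrite -lee_fin.
Qed.

Lemma compact_sublevel (f : X -> \bar R) (Q : R) (B : set X) (x0 : X) :
  (diam X < +oo)%E -> compact_sublevels f ->
  B `<=` [set x | (f x <= Q%:E)%E] -> precompact B.
Proof.
move=> /diam_bound[M HM] cf BQ; apply: (cf Q B _ BQ); exists x0, (M + 1) => y _.
by rewrite ballEmdist/= (le_lt_trans (HM _ _)) // ltrDl.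
Qed.

Lemma lsc_lower_bound (f : X -> \bar R) : (diam X < +oo)%E -> compact_sublevels f ->
  lower_semicontinuous f -> (forall x, (-oo < f x)%E) -> dom f !=set0 ->
  exists m : R, forall x, (m%:E <= f x)%E.
Proof.
move=> dX cf lf fNy [x0 dx0].
have f0 : (f x0 <= (fine (f x0))%:E)%E by rewrite dom_fineK.
have [z Hz] := lsc_minimizer f x0 _ lf fNy f0 (compact_sublevel f _ _ x0 dX cf (fun _ => id)).
exists (fine (f z)) => x; rewrite dom_fineK //; apply: dom_le.
exact: le_trans (Hz x0) f0.
Qed.

Context (phi1 phi2 : X -> \bar R).
Local Notation phi := (phi1 \+ phi2)%E.
Hypothesis X_diam : (diam X < +oo)%E.
Hypothesis phi1_gtNy : forall x, (-oo < phi1 x)%E.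
Hypothesis phi2_gtNy : forall x, (-oo < phi2 x)%E.
Hypothesis phi1_lsc : lower_semicontinuous phi1.
Hypothesis phi2_lsc : lower_semicontinuous phi2.
Hypothesis phi1_compact : compact_sublevels phi1.
Hypothesis phi2_compact : compact_sublevels phi2.
Hypothesis dom_nonempty : finite_dom phi1 phi2 !=set0.

Lemma sum_prox_exists (tau : R) (x : X) : 0 < tau -> exists z, prox [set: X] phi tau x z.
Proof.
move=> t0; have [x0 Dx0] := dom_nonempty.
have [m2 Hm2] : exists m : R, forall x, (m%:E <= phi2 x)%E.
  by apply: lsc_lower_bound => //; exists x0; case: Dx0.
have phiNy (y : X) : (-oo < phi y)%E by exact: sum_gtNy.
pose r y := mdist x y ^+ 2 / (2 * tau).
have r0 y : 0 <= r y by rewrite divr_ge0 ?sqr_ge0 // mulr_ge0 // ltW.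
have lG : lower_semicontinuous (fun y => phi y + (r y)%:E)%E.
  apply: (lsc_add _ (fun y => (r y)%:E)) => //; first by move=> y; exact: ltNyr.
    exact: lsc_add.
  exact: lsc_sqdist.
have GNy y : (-oo < phi y + (r y)%:E)%E.
  by apply: (sum_gtNy phi (fun y => (r y)%:E)) => //; exact: ltNyr.
have G0 : (phi x0 + (r x0)%:E <= (value phi1 phi2 x0 + r x0)%:E)%E.
  by rewrite sum_fineE.
have [|z Hz] := lsc_minimizer _ x0 _ lG GNy G0.
  (* As [phi2 >= m2] and the distance term is nonnegative, this sublevel lies in a sublevel of
     [phi1]. *)
  apply: (compact_sublevel phi1 (value phi1 phi2 x0 + r x0 - m2) _ x0) => // y /= hy.
  rewrite EFinB leeBrDr //; apply: le_trans hy.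
  apply: (@le_trans _ _ (phi1 y + phi2 y)%E); first exact: leeD2l.
  by rewrite leeDl // lee_fin.
exists z; split => //; apply/eqP; rewrite eq_le; apply/andP; split.
  by apply/ereal_infP => _ [w _ <-]; exact: Hz.
by apply: ereal_inf_lbound; exists z.
Qed.

Lemma discrete_solution_exists (z0 : X) (t : nat -> R) : partition_of_half_line t ->
  exists x, discrete_solution [set: X] phi z0 +oo%E t x.
Proof.
move=> [_ tlt _].
have ex (p : nat * X) : exists y, prox [set: X] phi (t p.1.+1 - t p.1) p.2 y.
  by apply: sum_prox_exists; rewrite subr_gt0.
have [sel Hsel] := choice ex.
exists (fun n => nat_rect (fun=> X) z0 (fun k x => sel (k, x)) n).
by split => // k _; exact: (Hsel (k, _)).
Qed.

End Minimizers.

(** * Propagation of the convergence *)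

Section Partitions.
Context {R : realType}.
Implicit Types t : nat -> R.

Lemma partition_unbounded t (s : R) : partition_of_half_line t -> exists n, s < t n.
Proof.
move=> [_ _ ty]; have [N _ HN] := (cvgryPgt t).1 ty s.
by exists N; apply: HN => /=.
Qed.

Lemma step_index_gt0 t (s : R) : partition_of_half_line t -> 0 < s ->
  exists k, step_index t s = k.+1 /\ t k < s <= t k.+1.
Proof.
move=> pt s0; rewrite /step_index.
suff [k hk] : exists k, t k < s <= t k.+1.
  have /(xgetPex 0%N)[j hj <-] : exists x, [set k.+1 | k in [set k | t k < s <= t k.+1]] x.
    by exists k.+1, k.
  by exists j.
have ex : exists n, s <= t n by have [n /ltW] := partition_unbounded t s pt; exists n.
case: (ex_minnP ex) => -[|k] sk mink; first by case: pt => t0 _ _; rewrite t0 in sk; lra.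
exists k; rewrite sk andbT ltNge; apply/negP => /mink; lia.
Qed.

(** No interval of the definition contains 0, so [xget] returns its default value. *)
Lemma step_index0 t : partition_of_half_line t -> step_index t 0 = 0%N.
Proof.
move=> pt; apply: xgetPN => _ [k /= /andP[tk _] _].
have := partition_mono t 0 k pt (leq0n k); case: pt => -> _ _; lra.
Qed.

Lemma step_index_bounds t (s e : R) : partition_of_half_line t -> (mesh t < e%:E)%E ->
  0 <= s -> 0 < e -> s <= t (step_index t s) < s + e.
Proof.
move=> pt mt; rewrite le_eqVlt => /orP[/eqP <- e0|s0 _].
  by rewrite step_index0 //; case: pt => -> _ _; rewrite lexx add0r.
have [k [-> /andP[k1 ->]]] := step_index_gt0 t s pt s0.
by have := mesh_lt t e k mt; lra.
Qed.

Lemma partition_shift t m : partition_of_half_line t ->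
  partition_of_half_line (fun i => t (m + i)%N - t m).
Proof.
move=> [t0 tlt ty]; split; first by rewrite addn0 subrr.
  by move=> k; rewrite ltrD2r addnS.
apply/cvgryPgt => A; have [N _ HN] := (cvgryPgt t).1 ty (A + t m).
exists N => // k /= Nk; rewrite ltrBrDr; apply: HN => /=; lia.
Qed.

Lemma mesh_shift t m : (mesh (fun i => (t (m + i)%N - t m)%R) <= mesh t)%E.
Proof.
apply/ereal_supP => _ [k _ <-]; apply: ereal_sup_ubound; exists (m + k)%N => //.
by rewrite addnS opprB addrA subrK.
Qed.

End Partitions.

(** * Passing the convergence from a time to later times *)

Section Propagation.
Context {R : realType} {X : metricType R} (phi1 phi2 : X -> \bar R).
Context (lambda1 lambda2 C L mu : R).
Hypothesis phi1_gtNy : forall x, (-oo < phi1 x)%E.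
Hypothesis phi2_gtNy : forall x, (-oo < phi2 x)%E.
Local Notation D := (finite_dom phi1 phi2).
Local Notation F := (value phi1 phi2).
Local Notation phi := (phi1 \+ phi2)%E.
Hypothesis reg : regular_geodesics phi1 phi2 lambda1 lambda2 C.
Hypothesis C0 : 0 <= C.
Hypothesis L1 : `|lambda1| <= L.
Hypothesis L2 : `|lambda2| <= L.
Hypothesis mu_le : forall x, D x -> mu <= F x.
Context (z0 : X) (xi : R -> X).
Hypothesis Dz0 : D z0.
Hypothesis defects : summable_defects phi1 phi2 z0.

Definition scheme_converges (T : R) : Prop :=
  converges_uniformly
    (fun t z => exists zhat, alternating_solution phi1 phi2 z0 t zhat z) T xi.

(** [controlled_holder] with [theta * E <= eta / 4], then [del] small against [theta]. The window
    [2 * del] leaves room for the overshoot of grid times. *)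
Lemma alternating_equicontinuous (T eta : R) : 0 < T -> 0 < eta ->
  exists2 del : R, 0 < del & forall t zh z k l, partition_of_half_line t ->
    (mesh t < del%:E)%E -> alternating_solution phi1 phi2 z0 t zh z ->
    t k <= T -> t l <= T -> `|t k - t l| <= 2 * del -> mdist (z k) (z l) < eta.
Proof.
move=> T0 eta0.
have [E E0 HE] := alternating_controlled _ _ phi1_gtNy phi2_gtNy _ mu_le _ _ Dz0 defects T0.
pose theta := eta / (4 * (E + 1)).
have th0 : 0 < theta by rewrite divr_gt0 //; lra.
have thE : theta * E <= eta / 4.
  have : theta * (4 * (E + 1)) = eta by rewrite divfK // gt_eqF //; lra.
  lra.
pose del := Num.min 1 (theta * (eta / 8)).
have del0 : 0 < del by rewrite lt_min ltr01 mulr_gt0 //; lra.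
have [del1 del2] : del <= 1 /\ del <= theta * (eta / 8) by rewrite !ge_min !lexx orbT.
exists del => // t zh z k l pt mt alt; wlog kl : k l / (k <= l)%N.
  move=> W tk tl d; have [kl|/ltnW lk] := leqP k l; first exact: W.
  by rewrite metric_sym; apply: W => //; rewrite distrC.
move=> tk tl d.
have mt1 : (mesh t < 1%:E)%E by apply: lt_le_trans mt _; rewrite lee_fin.
have [dl ctl] := HE t zh z l pt mt1 tl alt.
apply: le_lt_trans (controlled_holder _ _ E t zh z dl l k l theta pt ctl kl (leqnn _) th0) _.
have tkl : t l - t k <= 2 * del.
  by apply: le_trans (ler_norm _) _; rewrite distrC.
have : (t l - t k) / theta <= eta / 4.
  by rewrite ler_pdivrMr //; lra.
lra.
Qed.

(** Convergence at time [r] places the alternating scheme near [xi r]; from there it stays close to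
    the discrete solution started at [xi r] on the shifted partition, which follows [xi].
    Equicontinuity absorbs the shift between the two grids. *)
Lemma scheme_converges_stage (r T T' : R) (S : set X) (H : \bar R) :
  0 <= r -> r <= T -> T < r + T' -> (T'%:E <= H)%E ->
  scheme_converges r -> D (xi r) -> open S -> S (xi r) ->
  (exists2 del : R, 0 < del & forall t, partition_of_half_line t ->
     (mesh t < del%:E)%E -> exists x, discrete_solution S phi (xi r) H t x) ->
  converges_uniformly (discrete_solution S phi (xi r) H) T' (fun s => xi (r + s)) ->
  scheme_converges T.
Proof.
move=> r0 rT TT' T'H conv Dr oS Sr [del1 del10 Hex] Hflow eps eps0.
have e3 : 0 < eps / 3 by lra.
have T10 : 0 < T + 1 by lra.
have [rho [del2 [rho0 del20 Hclose]]] := alternating_close _ _ _ _ _ _ _ phi1_gtNy phi2_gtNy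
  reg C0 L1 L2 mu_le z0 (T + 1) Dz0 defects T10 (xi r) (eps / 3) Dr e3.
have [del3 del30 Hr] := conv rho rho0.
have [del4 del40 Hr'] := conv eps eps0.
have [del5 del50 Hf] := Hflow (eps / 3) e3.
have [del6 del60 Heq] := alternating_equicontinuous (T + 1) (eps / 3) T10 e3.
pose del := Num.min (Num.min (Num.min del1 del2) (Num.min del3 del4))
                    (Num.min (Num.min del5 del6) (2^-1)).
exists del; first by rewrite !lt_min del10 del20 del30 del40 del50 del60 invr_gt0 ltr0n.
move=> t z pt mt [zh alt] u /andP[u0 uT].
have [m1 [m2 [m3 [m4 [m5 [m6 m7]]]]]] : (mesh t < del1%:E)%E /\ (mesh t < del2%:E)%E /\
  (mesh t < del3%:E)%E /\ (mesh t < del4%:E)%E /\ (mesh t < del5%:E)%E /\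
  (mesh t < del6%:E)%E /\ (mesh t < (2^-1)%:E)%E.
  by do ![split]; apply: lt_le_trans mt _; rewrite lee_fin /del !ge_min !lexx ?orbT.
have [ur|ru] := leP u r.
  by apply: (Hr' t z pt m4 (ex_intro _ zh alt)); rewrite u0.
have [half0 del60'] : (0 : R) < 2^-1 /\ (0 : R) < del6 by split=> //; lra.
(* Time [t m] exceeds [r], and [s n.+1] exceeds [u - r], by less than the mesh; the bounds 1/2 keep
   [t (m + n.+1)] below [T + 1]. *)
set m := step_index t r.
have /andP[tm1 tm2] := step_index_bounds t r del6 pt m6 r0 del60.
have /andP[_ tm3] := step_index_bounds t r _ pt m7 r0 half0.
rewrite -/m in tm1 tm2 tm3.
pose s i := t (m + i)%N - t m.
have ps : partition_of_half_line s := partition_shift t m pt.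
have ms e : (mesh t < e%:E)%E -> (mesh s < e%:E)%E := le_lt_trans (mesh_shift t m).
have [x sol] := Hex s ps (ms _ m1).
have dm : mdist (z m) (xi r) < rho.
  by apply: (Hr t z pt m3 (ex_intro _ zh alt)); rewrite r0 lexx.
have v0 : 0 < u - r by lra.
have [n [nE /andP[sn1 sn2]]] := step_index_gt0 s (u - r) ps v0.
have d1 : mdist (x n.+1) (xi u) < eps / 3.
  have := Hf s x ps (ms _ m5) sol (u - r); rewrite /interpolate nE [r + _]addrC subrK.
  by apply; apply/andP; split; lra.
have sn3 := mesh_lt s _ n (ms _ m6); have sn4 := mesh_lt s _ n (ms _ m7).
have tmn : t (m + n.+1)%N = t m + s n.+1 by rewrite /s addrC subrK.
have tmn1 : t (m + n.+1)%N <= T + 1 by rewrite tmn; lra.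
have d2 : mdist (z (m + n.+1)%N) (x n.+1) < eps / 3.
  (* All steps up to index [n] start no later than [s n < u - r < T' <= H]. *)
  apply: (Hclose t zh z m S H x oS Sr pt m2 alt sol dm) => // i lin.
  apply: lt_le_trans T'H; rewrite lte_fin -/(s i).
  have := partition_mono s i n ps; rewrite -ltnS => /(_ lin); lra.
have /andP[tk1 tk2] := step_index_bounds t u del6 pt m6 u0 del60.
have /andP[_ tk3] := step_index_bounds t u _ pt m7 u0 half0.
(* The two indices may differ, but both grid times lie between [u] and [u + 2 * del6]. *)
have d3 : mdist (z (step_index t u)) (z (m + n.+1)%N) < eps / 3.
  apply: (Heq t zh z _ _ pt m6 alt) => //; first lra.
  by rewrite tmn ler_norml; apply/andP; split; lra.
rewrite /interpolate.
have := metric_triangle (z (step_index t u)) (z (m + n.+1)%N) (xi u).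
have := metric_triangle (z (m + n.+1)%N) (x n.+1) (xi u); lra.
Qed.

(** A stage gives convergence only before its end [b]. After [b - h'] the scheme moves little by
    equicontinuity, and [xi] by continuity. *)
Lemma scheme_converges_closure (b : R) : 0 < b ->
  (forall eps : R, 0 < eps -> exists2 h : R, 0 < h &
     forall s, 0 <= s -> `|b - s| < h -> mdist (xi b) (xi s) < eps) ->
  (forall T, 0 <= T < b -> scheme_converges T) -> scheme_converges b.
Proof.
move=> b0 cont conv eps eps0.
have e4 : 0 < eps / 4 by lra.
have b10 : 0 < b + 1 by lra.
have [h h0 Hh] := cont (eps / 4) e4.
have [del1 del10 Heq] := alternating_equicontinuous (b + 1) (eps / 4) b10 e4.
pose h' := Num.min (Num.min (h / 2) b) del1.
have h'0 : 0 < h' by rewrite !lt_min b0 del10 divr_gt0.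
have [h'1 h'2 h'3] : [/\ h' <= h / 2, h' <= b & h' <= del1] by rewrite !ge_min !lexx !orbT.
have Tb : 0 <= b - h' < b by apply/andP; split; lra.
have [del2 del20 HT] := conv _ Tb _ e4.
have [del3 del30 HT'] := conv _ Tb _ eps0.
pose del := Num.min (Num.min del1 del2) (Num.min del3 1).
exists del; first by rewrite !lt_min del10 del20 del30 ltr01.
move=> t z pt mt [zh alt] u /andP[u0 ub].
have [m1 [m2 [m3 m4]]] : (mesh t < del1%:E)%E /\ (mesh t < del2%:E)%E /\
  (mesh t < del3%:E)%E /\ (mesh t < 1%:E)%E.
  by do ![split]; apply: lt_le_trans mt _; rewrite lee_fin /del !ge_min !lexx ?orbT.
have [ur|ru] := leP u (b - h').
  by apply: (HT' t z pt m3 (ex_intro _ zh alt)); rewrite u0.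
have [w0 _] := andP Tb.
have d1 : mdist (z (step_index t (b - h'))) (xi (b - h')) < eps / 4.
  by apply: (HT t z pt m2 (ex_intro _ zh alt)); rewrite w0 lexx.
have d2 : mdist (xi b) (xi (b - h')) < eps / 4.
  by apply: Hh => //; rewrite ltr_norml; apply/andP; split; lra.
have d3 : mdist (xi b) (xi u) < eps / 4.
  by apply: Hh => //; rewrite ltr_norml; apply/andP; split; lra.
have /andP[k1 k2] := step_index_bounds t u _ pt m1 u0 del10.
have /andP[k3 k4] := step_index_bounds t (b - h') _ pt m1 w0 del10.
have /andP[_ k5] := step_index_bounds t u _ pt m4 u0 ltr01.
have /andP[_ k6] := step_index_bounds t (b - h') _ pt m4 w0 ltr01.
have d4 : mdist (z (step_index t u)) (z (step_index t (b - h'))) < eps / 4.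
  apply: (Heq t zh z _ _ pt m1 alt); [lra|lra|].
  by rewrite ler_norml; apply/andP; split; lra.
rewrite /interpolate.
have := metric_triangle (z (step_index t u)) (z (step_index t (b - h'))) (xi u).
have := metric_triangle (z (step_index t (b - h'))) (xi (b - h')) (xi u).
have := metric_triangle (xi (b - h')) (xi b) (xi u).
by rewrite [mdist (xi (b - h')) (xi b)]metric_sym; lra.
Qed.

Lemma scheme_converges0 : xi 0 = z0 -> scheme_converges 0.
Proof.
move=> xi0 eps eps0; exists 1 => // t z pt _ [zh [z00 _]] s.
by rewrite -eq_le => /eqP <-; rewrite /interpolate step_index0 // z00 xi0 mdistxx.
Qed.

End Propagation.

(** * Open balls, continuity on the half line, uniform partitions *)

Section Curves.
Context {R : realType} {X : metricType R}.

Lemma open_mball (x : X) (r : R) : open (ball x r).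
Proof.
rewrite openE => y; rewrite ballEmdist /= => xy; apply/nbhs_ballP.
exists (r - mdist x y) => /=; first by rewrite subr_gt0.
move=> w; rewrite !ballEmdist/= => yw.
by have := metric_triangle x y w; lra.
Qed.

Lemma within_half_line_continuous (xi : R -> X) (b eps : R) :
  {within `[0, +oo[, continuous xi} -> 0 <= b -> 0 < eps ->
  exists2 h : R, 0 < h & forall s, 0 <= s -> `|b - s| < h -> mdist (xi b) (xi s) < eps.
Proof.
move=> /subspace_continuousP cont b0 eps0.
have bA : [set` `[0 : R, +oo[] b by rewrite /= in_itv/= b0.
have /nbhs_ballP[h /= h0 Hh] := cont b bA _ (nbhsx_ballx (xi b) eps eps0).
exists h => // s s0 bs; have := Hh s bs; rewrite /= in_itv/= s0 ballEmdist.
by apply.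
Qed.

Lemma uniform_partition (del : R) : 0 < del ->
  exists2 t, partition_of_half_line t & (mesh t < del%:E)%E.
Proof.
move=> d0; have d2 : 0 < del / 2 by rewrite divr_gt0.
have step k : k.+1%:R * (del / 2) - k%:R * (del / 2) = del / 2.
  by rewrite -mulrBl -natrB // subSnn mul1r.
exists (fun k => k%:R * (del / 2)); last first.
  apply: (@le_lt_trans _ _ (del / 2)%:E); last by rewrite lte_fin; lra.
  by apply/ereal_supP => _ [k _ <-]; rewrite step.
split; first by rewrite mul0r.
  by move=> k; rewrite -subr_gt0 step.
apply/cvgryPge => A; near=> n; rewrite -ler_pdivrMr //.
by near: n; exact: nbhs_infty_ger.
Unshelve. all: by end_near. Qed.

End Curves.

(** * Convergence to the gradient curve: a single stage, or induction over local stages *)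

Theorem theorem5p4 (R : realType) (X : metricType R)
    (phi1 phi2 : X -> \bar R) (lambda1 lambda2 : R) (z0 : X) (xi : R -> X)
    (X_complete : complete_space X)
    (X_diam : (diam X < +oo)%E)
    (phi1_gtNy : forall x, (-oo < phi1 x)%E)
    (phi2_gtNy : forall x, (-oo < phi2 x)%E)
    (phi1_lsc : lower_semicontinuous phi1)
    (phi2_lsc : lower_semicontinuous phi2)
    (common_dom : dom phi1 `&` dom phi2 !=set0)
    (phi1_compact : compact_sublevels phi1)
    (phi2_compact : compact_sublevels phi2)
    (phi1_convex : lambda_convex phi1 lambda1)
    (phi2_convex : lambda_convex phi2 lambda2)
    (z0_dom : dom (phi1 \+ phi2)%E z0)
    (setting :
      (CAT1_space X /\ CAT1_gradient_curve (phi1 \+ phi2)%E z0 xi) \/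
      (commutative_K_convex_setting phi1 phi2 lambda1 lambda2 /\
       gradient_curve (phi1 \+ phi2)%E z0 xi))
    (defects : summable_defects phi1 phi2 z0) :
  forall T : R, 0 <= T ->
    converges_uniformly
      (fun t z => exists zhat, alternating_solution phi1 phi2 z0 t zhat z)
      T xi.
Proof.
have domE := dom_sum _ _ phi1_gtNy phi2_gtNy.
have Dz0 := (domE z0).1 z0_dom.
have [x0 [x01 x02]] := common_dom.
have [m1 Hm1] := lsc_lower_bound _ X_diam phi1_compact phi1_lsc phi1_gtNy (ex_intro _ x0 x01).
have [m2 Hm2] := lsc_lower_bound _ X_diam phi2_compact phi2_lsc phi2_gtNy (ex_intro _ x0 x02).
have mu_le x : finite_dom phi1 phi2 x -> m1 + m2 <= value phi1 phi2 x.
  move=> Dx; rewrite -lee_fin -sum_fineE // EFinD; exact: leeD.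
pose L := Num.max `|lambda1| `|lambda2|.
have L1 : `|lambda1| <= L by rewrite le_max lexx.
have L2 : `|lambda2| <= L by rewrite le_max lexx orbT.
have [C C0 reg] : exists2 C, 0 <= C & regular_geodesics phi1 phi2 lambda1 lambda2 C.
  case: setting => [[cat _]|[K _]]; last exact: commutative_regular K.
  by exists 12 => //; exact: CAT1_regular.
have stage := scheme_converges_stage _ _ _ _ _ _ _ phi1_gtNy phi2_gtNy reg C0 L1 L2 mu_le
  z0 xi Dz0 defects.
have start := scheme_converges0 phi1 phi2 z0 xi.
have global : gradient_curve (phi1 \+ phi2)%E z0 xi -> forall T : R, 0 <= T ->
    scheme_converges phi1 phi2 z0 xi T.
  move=> [xiD Hxi] T T0.
  have exs := discrete_solution_exists _ _ X_diam phi1_gtNy phi2_gtNy phi1_lsc phi2_lsc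
    phi1_compact phi2_compact common_dom z0.
  (* The initial value is recovered from uniform convergence at time 0, where every discrete curve
     equals [z0]. *)
  have xi0 : xi 0 = z0.
    apply: mdist_positivity; apply/eqP; rewrite eq_le mdist_ge0 andbT leNgt.
    apply/negP => d0; have [del del0 Hdel] := Hxi 0 (lexx _) _ d0.
    have [t pt mt] := uniform_partition del del0.
    have [x sol] := exs t pt; have := Hdel t x pt mt sol 0.
    rewrite !lexx /interpolate step_index0 // sol.1 metric_sym ltxx.
    by move=> /(_ isT).
  have T1 : T < 0 + (T + 1) by lra.
  have T10 : 0 <= T + 1 by lra.
  (* The whole space is a single stage from time 0 without time limit; the horizon [T + 1] provides
     the strict inequality. *)
  apply: (stage 0 T (T + 1) [set: X] +oo%E (lexx _) T0 T1 (leey _) (start xi0)).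
  - by rewrite xi0.
  - exact: openT.
  - by [].
  - by exists 1 => // t pt _; rewrite xi0; exact: exs.
  - rewrite xi0 (_ : (fun s => xi (0 + s)) = xi); first exact: (Hxi _ T10).
    by apply/funext => s; rewrite add0r.
case: setting => [[_ [small large]]|[_ grad]]; last exact: global.
have [/small|/large {small large}] := ltP (diam X) (pi / 2)%:E; first exact: global.
move=> [xi0 cont xiD [a [a0 stages aoo ay]]].
(* Induction over the stage times [a j], which eventually exceed every [T]. *)
suff prop j : (0%:E <= a j)%E /\ forall T : R, 0 <= T -> (T%:E <= a j)%E ->
    scheme_converges phi1 phi2 z0 xi T.
  move=> T T0; have [N _ HN] := (cvgeyPge _).1 ay T.
  by apply: (prop N).2 => //; apply: HN => /=.
elim: j => [|j [aj0 IH]].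
  rewrite a0; split => // T T0; rewrite lee_fin => T0'.
  have -> : T = 0 by apply/eqP; rewrite eq_le T0'.
  exact: start.
case aE : (a j) aj0 IH => [r||] r0 IH; [|by rewrite aoo|by []].
rewrite lee_fin in r0.
have [rb _ _ flow] := stages j r aE.
move: rb flow; set b := a j.+1 => rb flow.
(* Strictly inside the stage there is [T1] with [T < T1 < b], and the restricted scheme is run for
   the time [T1 - r]. *)
have inner T : r <= T -> (T%:E < b)%E -> scheme_converges phi1 phi2 z0 xi T.
  move=> rT Tb.
  have [T1 [TT1 T1b]] : exists T1 : R, T < T1 /\ (T1%:E < b)%E.
    move: Tb; case: (b) => [c||] //; rewrite ?lte_fin => Tb.
      by exists ((T + c) / 2); rewrite lte_fin; split; lra.
    by exists (T + 1); rewrite ltry; split => //; lra.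
  have v0 : 0 <= T1 - r by lra.
  have v1 : ((T1 - r)%:E < b - r%:E)%E by rewrite lteBrDr // -EFinD subrK.
  have [ex conv] := flow (T1 - r) v0 v1.
  have TT : T < r + (T1 - r) by lra.
  apply: (stage r T (T1 - r) _ _ r0 rT TT (lexx _) _ _ (open_mball _ _) _ ex conv).
  - by apply: IH.
  - by apply/domE; apply: xiD.
  - by apply: ballxx; rewrite divr_gt0 ?pi_gt0.
split; first by apply: ltW; apply: le_lt_trans rb; rewrite lee_fin.
move=> T T0 Tb; have [Tr|/ltW rT] := leP T r; first by apply: IH => //; rewrite lee_fin.
(* The end point [T = b] is reached by closure, which makes it available as the start of the next
   stage. *)
move: Tb; rewrite le_eqVlt => /orP[/eqP Tb|]; last exact: inner.
have rT' : r < T by rewrite -lte_fin Tb.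
apply: (scheme_converges_closure phi1 phi2 _ phi1_gtNy phi2_gtNy mu_le z0 xi Dz0 defects).
- exact: le_lt_trans rT'.
- by move=> eps eps0; apply: within_half_line_continuous.
- move=> T' /andP[T'0 T'T]; have [T'r|/ltW rT''] := leP T' r.
    by apply: IH => //; rewrite lee_fin.
  by apply: inner => //; rewrite -Tb lte_fin.
Qed.
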